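(* Let $d\ge1$, $0<\gamma<1$, $\theta=(\theta_1,\dots,\theta_d)$ (row vector) with $\theta_i\ge0$, $\Theta=\operatorname{diag}(\theta_1,\dots,\theta_d)$, $N=\operatorname{diag}(\nu_1,\dots,\nu_d)$, $P=\operatorname{diag}(\rho_1,\dots,\rho_d)$ with $\rho_i\in[-1,1]$, $D\in\mathbb R^{d\times d}$ with $D_{ij}\ge0$ for $i\neq j$, $\Lambda=D+\frac{\gamma}{1-\gamma}NP\Theta$, and $K=\operatorname{diag}(K_1,\dots,K_d)$ with $K_i\in L^2_{\mathrm{loc}}(\mathbb R_+,\mathbb R)$. For a row-vector valued function $\psi$ write $\Psi=\operatorname{diag}(\psi_1,\dots,\psi_d)$. Each of the following Riccati–Volterra equations has a unique non-continuable continuous solution $(\psi,T_{\max})$: (i) when $\rho_1=\dots=\rho_d=\rho$ and $c=\frac{1-\gamma}{1-\gamma+\gamma\rho^2}$, $$\psi(t)=\int_0^tF_1(\psi)(t-s)K(s)ds,\qquad F_1(\psi)=\frac{\gamma}{2c(1-\gamma)}\theta\Theta+\psi\Lambda+\frac12\psi N^2\Psi;$$ (ii) $$\psi(t)=\int_0^tF_2(\psi)(t-s)K(s)ds,\qquad F_2(\psi)=\frac{\gamma}{2(1-\gamma)}\theta\Theta+\psi\Lambda+\frac12\Big(\psi N^2\Psi+\frac{\gamma}{1-\gamma}\psi N^2P^2\Psi\Big).$$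
   Context: $F(\psi)$ is evaluated pointwise: $F(\psi)(u)=F(\psi(u))$. A non-continuable solution of $\psi(t)=\int_0^tF(\psi)(t-s)K(s)ds$ is a pair $(\psi,T_{\max})$, $T_{\max}\in(0,\infty]$, with $\|\psi\|_{L^2[0,T]}<\infty$ for every $T<T_{\max}$, $\psi$ satisfying the equation on $[0,T_{\max})$, and $\|\psi\|_{L^2[0,T_{\max}]}=\infty$ if $T_{\max}<\infty$. It is unique if for any $T>0$ and any $\tilde\psi$ with $\|\tilde\psi\|_{L^2[0,T]}<\infty$ satisfying the equation on $[0,T]$ one has $T<T_{\max}$ and $\tilde\psi=\psi$ on $[0,T]$. *)

(* Defs.v *)
From HB Require Import structures.
From mathcomp Require Import all_boot all_order all_algebra.
From mathcomp Require Import all_classical all_reals all_analysis.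

Set Implicit Arguments.
Unset Strict Implicit.
Unset Printing Implicit Defensive.
Import Order.TTheory GRing.Theory Num.Theory.
Import numFieldNormedType.Exports.

Local Open Scope classical_set_scope.
Local Open Scope ring_scope.

Definition enorm (R : realType) (d : nat) (u : 'rV[R]_d) : R :=
  Num.sqrt (\sum_(i < d) u ord0 i ^+ 2).

Definition L2norm (R : realType) (A : set R) (f : R -> R) : \bar R :=
  'N[lebesgue_measure]_2%:E[(EFin \o f) \_ A].

Definition L2loc (R : realType) (k : R -> R) : Prop :=
  forall T : R, 0 < T ->
    measurable_fun `[0, T] k /\ (L2norm `[0%R, T] k < +oo)%E.

Definition vec_L2 (R : realType) (d : nat) (A : set R) (psi : R -> 'rV[R]_d) :
    Prop :=
  (forall i, measurable_fun A (fun t => psi t ord0 i)) /\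
  (L2norm A (fun t => enorm (psi t)) < +oo)%E.

(* The Lebesgue integral below is total, with a meaningless value when the
   integrand is not integrable; integrability is therefore part of the
   equation. *)
Definition solves_at (R : realType) (d : nat) (F : 'rV[R]_d -> 'rV[R]_d)
    (K : R -> 'M[R]_d) (psi : R -> 'rV[R]_d) (t : R) : Prop :=
  let integrand (i : 'I_d) (s : R) := (F (psi (t - s)) *m K s) ord0 i in
  (forall i, (@lebesgue_measure R).-integrable `[0, t] (EFin \o integrand i)) /\
  psi t = \row_i Rintegral lebesgue_measure `[0, t] (integrand i).

(* [0, Tmax), with Tmax possibly infinite *)
Definition lifespan (R : realType) (Tmax : \bar R) : set R :=
  [set t : R | 0 <= t /\ (t%:E < Tmax)%E].

(* The value of psi outside [0, Tmax) is irrelevant: in the last clause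
   the point Tmax itself is Lebesgue-negligible. *)
Definition noncontinuable (R : realType) (d : nat)
    (F : 'rV[R]_d -> 'rV[R]_d) (K : R -> 'M[R]_d)
    (psi : R -> 'rV[R]_d) (Tmax : \bar R) : Prop :=
  [/\ (0 < Tmax)%E,
      forall T : R, 0 < T -> (T%:E < Tmax)%E -> vec_L2 `[0, T] psi,
      forall t, lifespan Tmax t -> solves_at F K psi t
    & forall T : R, Tmax = T%:E ->
        L2norm `[0, T] (fun t => enorm (psi t)) = +oo%E].

(* An element phi of L^2[0,T] is only defined up to null sets, so phi is only
   asked to satisfy the equation almost everywhere.  The conclusion gives
   phi = psi almost everywhere on [0,T], and everywhere on [0,T] as soon as phi
   satisfies the equation everywhere on [0,T]. *)
Definition unique_solution (R : realType) (d : nat)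
    (F : 'rV[R]_d -> 'rV[R]_d) (K : R -> 'M[R]_d)
    (psi : R -> 'rV[R]_d) (Tmax : \bar R) : Prop :=
  forall (T : R) (phi : R -> 'rV[R]_d), 0 < T ->
    vec_L2 `[0, T] phi ->
    {ae (@lebesgue_measure R), forall t, 0 <= t <= T -> solves_at F K phi t} ->
    (T%:E < Tmax)%E /\
    (forall t, 0 <= t <= T -> solves_at F K phi t -> phi t = psi t).

Definition has_unique_noncontinuable_continuous_solution (R : realType)
    (d : nat) (F : 'rV[R]_d -> 'rV[R]_d) (K : R -> 'M[R]_d) : Prop :=
  exists (psi : R -> 'rV[R]_d) (Tmax : \bar R),
    [/\ noncontinuable F K psi Tmax,
        {within lifespan Tmax, continuous psi}
      & unique_solution F K psi Tmax].

Definition F1 (R : realType) (d : nat) (gamma c : R) (theta nu : 'rV[R]_d)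
    (Lambda : 'M[R]_d) (u : 'rV[R]_d) : 'rV[R]_d :=
  let Theta := diag_mx theta in
  let N := diag_mx nu in
  (gamma / (2 * c * (1 - gamma))) *: (theta *m Theta) + u *m Lambda
  + 2^-1 *: (u *m N ^+ 2 *m diag_mx u).

Definition F2 (R : realType) (d : nat) (gamma : R) (theta nu rho : 'rV[R]_d)
    (Lambda : 'M[R]_d) (u : 'rV[R]_d) : 'rV[R]_d :=
  let Theta := diag_mx theta in
  let N := diag_mx nu in
  let P := diag_mx rho in
  (gamma / (2 * (1 - gamma))) *: (theta *m Theta) + u *m Lambda
  + 2^-1 *: (u *m N ^+ 2 *m diag_mx u
             + (gamma / (1 - gamma)) *: (u *m N ^+ 2 *m P ^+ 2 *m diag_mx u)).

(* Main.v *)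
(* On the space of continuous functions with weight [expR (- n t)], [n] large, the equation
   with [F] composed with a truncation [clamp M] is a contraction, hence has a global
   continuous solution; it solves the original equation as long as it stays below [M].
   Two square-integrable solutions agree: with [delta] their distance and [w] one plus
   their norms, [H = delta w] satisfies [H <= C w (H * |K|)] with a convolution; Tonelli
   and [w |K| <= (w^2 / A + A |K|^2) / 2] bound the weighted integral of [H] by half of
   itself.  The same inequality, applied to the supremum instead of the integral, shows
   that a continuous solution on [[0, T)] that is square-integrable is bounded, so that it
   extends beyond [T] by solving the equation truncated at a higher level.  Hence the union
   of all continuous solutions has infinite L^2 norm at a finite end point, and an L^2
   solution, which agrees with it, cannot reach that point. *)
Require Import Defs.
From HB Require Import structures.
From mathcomp Require Import all_boot all_order all_algebra.
From mathcomp Require Import all_classical all_reals all_analysis.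
From mathcomp Require Import measurable_realfun ring lra.
Import Order.TTheory GRing.Theory Num.Theory.
Import numFieldNormedType.Exports.
Set Implicit Arguments.
Unset Strict Implicit.
Unset Printing Implicit Defensive.

Local Open Scope classical_set_scope.
Local Open Scope ring_scope.

(** * Reflections and translations of the Lebesgue integral *)

(** The nonlinearity is quadratic and the kernel only square-integrable, so for [psi] in L^2 the
    function [F(psi)] is merely integrable, and its convolution with [K] has no pointwise bound by
    L^2 norms of [psi]. In both main estimates the quadratic term is therefore split: one factor is
    kept as a known L^2 function and paired with [K], the other is the unknown, measured in a norm
    for which the convolution halves it. For two L^2 solutions that norm has to be an integral,
    since nothing better is known of their difference; for a continuous solution a maximum is
    available, and this is what yields a bound. The known factor occurs only through translates and
    reflections, all of the same L^2 norm, so one exponent [n] serves all times at once. Both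
    Riccati maps enter through the estimate [quad_lipschitz]. *)

Lemma pushforward_reflect (R : realType) (t : R) (A : set R) :
  measurable A ->
  pushforward (@lebesgue_measure R) ((fun s => t - s) : R -> measurableTypeR R) A
  = lebesgue_measure A.
Proof.
have mr : measurable_fun [set: R] (fun s : R => t - s) by exact: measurable_funB.
move=> mA; apply/esym/lebesgue_measure_unique => //= _ [[a b]] _ <-.
rewrite /pushforward/=.
(* Lebesgue measure is determined by its values on half-open intervals; the reflection moves the
   closed end to the other side, which leaves the length unchanged. *)
have -> : (fun s : R => t - s) @^-1` `]a, b] = `[t - b, t - a[%classic.
  by apply/seteqP; split=> s /=; rewrite !in_itv/= => /andP[? ?]; apply/andP; split; lra.
rewrite !lebesgue_measure_itv /= !lte_fin ltrD2l ltrN2.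
case: ifP => // _; rewrite -!EFinB; congr EFin; lra.
Qed.

Lemma ge0_integral_reflect (R : realType) (t : R) (f : R -> \bar R) :
  measurable_fun setT f -> (forall x, 0 <= f x)%E ->
  (\int[lebesgue_measure]_s f (t - s)%R = \int[lebesgue_measure]_s f s)%E.
Proof.
move=> mf f0.
have mr : measurable_fun [set: R] (fun s : R => t - s) by exact: measurable_funB.
transitivity (\int[pushforward (@lebesgue_measure R)
    ((fun s => (t - s)%R) : R -> measurableTypeR R)]_s f s)%E.
  by rewrite ge0_integral_pushforward.
apply: eq_measure_integral => //= A mA _; exact: pushforward_reflect.
Qed.

(** A translation is the composition of the reflections [t - s] and [0 - s]. *)
Lemma ge0_integral_shift (R : realType) (t : R) (f : R -> \bar R) :
  measurable_fun setT f -> (forall x, 0 <= f x)%E ->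
  (\int[lebesgue_measure]_s f (s - t)%R = \int[lebesgue_measure]_s f s)%E.
Proof.
move=> mf f0.
have mr : measurable_fun [set: R] (fun s : R => 0 - s) by exact: measurable_funB.
rewrite -[RHS](@ge0_integral_reflect _ 0)//.
rewrite -[RHS](@ge0_integral_reflect _ t)//.
- by apply: eq_integral => s _; rewrite sub0r opprB.
- exact: (measurableT_comp mf mr).
Qed.

Lemma measurable_laplace_weight (R : realType) (a : R) :
  measurable_fun [set: R] (fun s : R => expR (- (a * s))).
Proof.
apply: measurableT_comp; first exact: measurable_expR.
by apply: measurable_funN; exact: mulrl_measurable.
Qed.

(** Dominated convergence with [f] itself as dominating function: for [s > 0] the weight tends to
    [0], and for [s < 0], where it would blow up, [f] vanishes. *)
Lemma laplace_weight_small (R : realType) (f : R -> R) (eps : R) :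
  measurable_fun [set: R] f -> (forall s, 0 <= f s) -> (forall s, s < 0 -> f s = 0) ->
  (\int[lebesgue_measure]_s (f s)%:E < +oo)%E -> 0 < eps ->
  exists n : nat,
    (\int[lebesgue_measure]_s (expR (- (n%:R * s)) * f s)%:E <= eps%:E)%E.
Proof.
move=> mf f0 fneg fint eps0.
(* At [s = 0] the weight is [1] for every [n]; this null point is removed. *)
pose D := ~` [set (0 : R)].
have mD : measurable D by exact: measurableC.
have mfn n : measurable_fun [set: R] (fun s : R => expR (- (n%:R * s)) * f s).
  by apply: measurable_funM => //; exact: measurable_laplace_weight.
have intD n : (\int[lebesgue_measure]_s (expR (- (n%:R * s)) * f s)%:E =
    \int[lebesgue_measure]_(s in D) (expR (- (n%:R * s)) * f s)%:E)%E.
  rewrite /D -setTD integral_setD1//; first by rewrite setTD.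
  by apply/measurable_EFinP; apply: measurable_funS (mfn n).
have cv : (\int[lebesgue_measure]_(s in D) (expR (- (n%:R * s)) * f s)%:E
    @[n --> \oo] --> \int[lebesgue_measure]_(s in D) (cst 0%E s))%E.
  apply: (@dominated_cvg _ (measurableTypeR R) R lebesgue_measure D mD
    (fun n s => (expR (- (n%:R * s)) * f s)%:E) (cst 0%E) (EFin \o f)).
  - by move=> n; apply/measurable_EFinP; apply: measurable_funS (mfn n).
  - move=> s Ds; apply/fine_cvgP; split; first exact: nearW.
    rewrite /comp/=; have [s0|s0|s0] := ltgtP s 0; last by exfalso; exact: Ds.
      by rewrite fneg//; under eq_fun do rewrite mulr0; exact: cvg_cst.
    rewrite -(mul0r (f s)); apply: cvgMl.
    under eq_fun do rewrite -mulrN expRM_natl.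
    by apply: cvg_expr; rewrite ger0_norm ?expR_ge0// expR_lt1 oppr_lt0.
  - by [].
  - apply/integrableP; split; first by apply/measurable_EFinP; apply: measurable_funS mf.
    apply: le_lt_trans fint; rewrite /D -setTD integral_setD1//; last 2 first.
    + by rewrite setTD.
    + apply: measurableT_comp => //.
      by apply/measurable_EFinP; apply: measurable_funS mf.
    rewrite le_eqVlt; apply/orP; left; apply/eqP; apply: eq_integral => s _.
    by rewrite /= ger0_norm.
  - move=> n s Ds; rewrite abse_EFin lee_fin ger0_norm ?mulr_ge0 ?expR_ge0//.
    have [s0|s0] := ltP s 0; first by rewrite fneg// mulr0.
    by rewrite ler_piMl// -expR0 ler_expR oppr_le0 mulr_ge0.
rewrite integral0 in cv.
have /fine_cvgP[fin cvr] := cv.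
have [N _ NP] := @cvgr_lt _ _ _ _ _ _ cvr eps eps0.
have [M _ MP] := fin.
(* [N] makes the real part of the integral small, [M] makes the integral finite, so that it equals
   its real part. *)
exists (maxn N M); rewrite intD.
have := NP (maxn N M) (leq_maxl _ _).
have := MP (maxn N M) (leq_maxr _ _) => /= Fin /ltW.
by rewrite -lee_fin fineK.
Qed.

(** * A Volterra inequality *)

Lemma mul_le_AMGM (R : realFieldType) (a x y : R) : 0 < a ->
  x * y <= 2^-1 * (x ^+ 2 / a + a * y ^+ 2).
Proof.
move=> a0; have := sqr_ge0 (x - a * y); rewrite sqrrB => h.
rewrite -(ler_pM2l a0).
have -> : a * (2^-1 * (x ^+ 2 / a + a * y ^+ 2)) =
  2^-1 * (x ^+ 2 + (a * y) ^+ 2) by field; rewrite gt_eqF.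
lra.
Qed.

(* By AM-GM, [V * kappa <= (V^2 / A + A * kappa^2) / 2]: the first term is small for [A]
   large, and then the second one for [n] large. *)
Lemma weighted_kernel_small (R : realType) (C J : R) (kappa : R -> R) :
  0 <= C -> 0 <= J -> measurable_fun [set: R] kappa ->
  (forall t, 0 <= kappa t) -> (forall t, t < 0 -> kappa t = 0) ->
  (\int[lebesgue_measure]_t (kappa t ^+ 2)%:E < +oo)%E ->
  exists n : nat, forall V : R -> R, measurable_fun [set: R] V ->
    (forall t, 0 <= V t) -> (\int[lebesgue_measure]_t (V t ^+ 2)%:E <= J%:E)%E ->
    (C%:E * \int[lebesgue_measure]_s (V s * (expR (- (n%:R * s)) * kappa s))%:E
      <= (2^-1)%:E)%E.
Proof.
move=> C0 J0 mk k0 kneg kint.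
(* With this [A] the first AM-GM term, [C J / (2 A)], is at most [1/4]. The bound of the weighted
   integral of [kappa ^+ 2] in [e0] makes the second one [C / (4 (C + 1))], again at most [1/4]. *)
pose A := 2 * C * J + 1.
have A0 : 0 < A by rewrite ltr_wpDl// !mulr_ge0.
have mk2 : measurable_fun [set: R] (fun s => kappa s ^+ 2) by exact: measurable_funX.
have e0 : 0 < (2 * (C + 1) * A)^-1 by rewrite invr_gt0 !mulr_gt0// ltr_wpDl.
have [] := laplace_weight_small mk2 _ _ kint e0.
- by move=> s; exact: sqr_ge0.
- by move=> s s0; rewrite kneg// expr0n.
move=> n nsmall; exists n => V mV V0 VJ.
pose w (s : R) := expR (- (n%:R * s)).
have w0 s : 0 <= w s by exact: expR_ge0.
have mw : measurable_fun [set: R] w by exact: measurable_laplace_weight.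
pose g t := C * (2^-1 * (V t ^+ 2 / A + A * (w t * kappa t ^+ 2))).
have mwk : measurable_fun [set: R] (fun s => w s * kappa s ^+ 2) by exact: measurable_funM.
have mV2 : measurable_fun [set: R] (fun t => V t ^+ 2) by exact: measurable_funX.
have VA0 t : 0 <= V t ^+ 2 / A + A * (w t * kappa t ^+ 2).
  by rewrite addr_ge0 ?divr_ge0 ?sqr_ge0 ?(ltW A0)// !mulr_ge0 ?sqr_ge0 ?(ltW A0).
rewrite -ge0_integralZl_EFin//; last 2 first.
- by move=> s _; rewrite lee_fin !mulr_ge0.
- by apply/measurable_EFinP; do 2 apply: measurable_funM => //.
apply: (@le_trans _ _ (\int[lebesgue_measure]_t (g t)%:E)%E).
  apply: ge0_le_integral => //.
  - by move=> t _; rewrite -EFinM lee_fin !mulr_ge0.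
  - by apply/measurable_EFinP; do 3 apply: measurable_funM => //.
  - apply/measurable_EFinP; do 2 apply: measurable_funM => //.
    by apply: measurable_funD; apply: measurable_funM.
  move=> t _; rewrite -EFinM lee_fin.
  rewrite /g ler_wpM2l//; apply: le_trans (mul_le_AMGM _ _ A0) _.
  rewrite ler_pM2l ?invr_gt0// lerD2l ler_pM2l//.
  rewrite exprMn; have [tr|tr] := ltP t 0.
    by rewrite kneg// expr0n !mulr0.
  rewrite ler_wpM2r ?sqr_ge0// expr2 ler_piMl//.
  by rewrite -expR0 ler_expR oppr_le0 mulr_ge0.
have mV2A : measurable_fun [set: R] (fun t => (C * 2^-1 * A^-1)%:E * (V t ^+ 2)%:E)%E.
  by apply/measurable_EFinP; exact: measurable_funM.
have mk2A : measurable_fun [set: R]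
    (fun t => (C * 2^-1 * A)%:E * (w t * kappa t ^+ 2)%:E)%E.
  by apply/measurable_EFinP; exact: measurable_funM.
have CA : 0 <= C * 2^-1 * A^-1 by rewrite !mulr_ge0// invr_ge0 ltW.
have CA' : 0 <= C * 2^-1 * A by rewrite !mulr_ge0// ltW.
have wk0 s : (0 <= (w s * kappa s ^+ 2)%:E)%E by rewrite lee_fin mulr_ge0// sqr_ge0.
have Vt0 s : (0 <= (V s ^+ 2)%:E)%E by rewrite lee_fin sqr_ge0.
have -> : (\int[lebesgue_measure]_t (g t)%:E =
    (C * 2^-1 * A^-1)%:E * (\int[lebesgue_measure]_t (V t ^+ 2)%:E) +
    (C * 2^-1 * A)%:E * \int[lebesgue_measure]_s (w s * kappa s ^+ 2)%:E)%E.
  rewrite -ge0_integralZl_EFin//; last exact/measurable_EFinP.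
  rewrite -ge0_integralZl_EFin//; last exact/measurable_EFinP.
  rewrite -ge0_integralD//.
  - apply: eq_integral => t _; rewrite -!EFinM -EFinD; congr EFin.
    by rewrite /g; ring.
  - by move=> t _; rewrite mule_ge0.
  - by move=> t _; rewrite mule_ge0.
apply: (@le_trans _ _ ((C * 2^-1 * A^-1)%:E * J%:E + (C * 2^-1 * A)%:E *
    ((2 * (C + 1) * A)^-1)%:E)%E).
  by apply: leeD; rewrite lee_wpmul2l.
rewrite -!EFinM -EFinD lee_fin.
have C1 : 0 < C + 1 by exact: ltr_wpDl.
have CJ : 0 <= C * J by exact: mulr_ge0.
have e1 : C * 2^-1 * A^-1 * J <= 4^-1.
  rewrite mulrAC -(ler_pM2r A0) mulfVK ?gt_eqF// /A; lra.
have e2 : C * 2^-1 * A * (2 * (C + 1) * A)^-1 <= 4^-1.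
  have -> : C * 2^-1 * A * (2 * (C + 1) * A)^-1 = C / (4 * (C + 1)).
    by field; rewrite !gt_eqF.
  by rewrite ler_pdivrMr ?mulr_gt0//; lra.
lra.
Qed.

(* The factor [expR (- n s)] makes the convolution with [kappa] a contraction on
   the whole support at once, so no subdivision into short intervals is needed. *)
Lemma volterra_ineq_null (R : realType) (C : R) (H W kappa : R -> R) :
  0 <= C -> measurable_fun [set: R] H -> measurable_fun [set: R] W ->
  measurable_fun [set: R] kappa ->
  (forall t, 0 <= H t) -> (forall t, 0 <= W t) -> (forall t, 0 <= kappa t) ->
  (forall t, t < 0 -> H t = 0) -> (forall t, t < 0 -> kappa t = 0) ->
  (\int[lebesgue_measure]_t (H t)%:E < +oo)%E ->
  (\int[lebesgue_measure]_t (W t ^+ 2)%:E < +oo)%E ->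
  (\int[lebesgue_measure]_t (kappa t ^+ 2)%:E < +oo)%E ->
  {ae @lebesgue_measure R, forall t, ((H t)%:E <=
     (C * W t)%:E * \int[lebesgue_measure]_s (H (t - s)%R * kappa s)%:E)%E} ->
  forall t, (\int[lebesgue_measure]_s (H (t - s)%R * kappa s)%:E = 0)%E.
Proof.
move=> C0 mH mW mk H0 W0 k0 Hneg kneg Hint Wint kint HW.
pose J := fine (\int[lebesgue_measure]_t (W t ^+ 2)%:E)%E.
have JE : (\int[lebesgue_measure]_t (W t ^+ 2)%:E = J%:E)%E.
  by rewrite fineK// ge0_fin_numE//; apply: integral_ge0 => t _; rewrite lee_fin sqr_ge0.
have J0 : 0 <= J by apply/fine_ge0/integral_ge0 => t _; rewrite lee_fin sqr_ge0.
have [n nsmall] := weighted_kernel_small C0 J0 mk k0 kneg kint.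
pose w (s : R) := expR (- (n%:R * s)).
have w0 s : 0 <= w s by exact: expR_ge0.
have mw : measurable_fun [set: R] w by exact: measurable_laplace_weight.
(* Because the weight is multiplicative, weighting a convolution amounts to weighting both of its
   factors. *)
have wD s t : w (t - s) * w s = w t by rewrite /w -expRD; congr expR; ring.
pose Hn s := w s * H s; pose kn s := w s * kappa s.
have mHn : measurable_fun [set: R] Hn by exact: measurable_funM.
have mkn : measurable_fun [set: R] kn by exact: measurable_funM.
have Hn0 s : 0 <= Hn s by exact: mulr_ge0.
have kn0 s : 0 <= kn s by exact: mulr_ge0.
have msub (t : R) : measurable_fun [set: R] (fun s : R => t - s) by exact: measurable_funB.
have mHnI : (\int[lebesgue_measure]_t (Hn t)%:E < +oo)%E.
  apply: le_lt_trans Hint; apply: ge0_le_integral => //.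
  - by move=> t _; rewrite lee_fin.
  - exact/measurable_EFinP.
  - exact/measurable_EFinP.
  move=> t _; rewrite lee_fin /Hn; have [t0|t0] := ltP t 0.
    by rewrite Hneg// mulr0.
  by rewrite ler_piMl// -expR0 ler_expR oppr_le0 mulr_ge0.
(* Here [z.1] is the time [t] and [z.2] the variable [r = t - s]. Integration in [r] gives the
   weighted right-hand side of the inequality; integration in [t] pairs [W] with the kernel and
   leaves [Hn r] outside. *)
pose f (z : R * R) := (C * W z.1 * (Hn z.2 * kn (z.1 - z.2)))%:E.
have f0 z : (0 <= f z)%E by rewrite lee_fin !mulr_ge0.
have mf : measurable_fun [set: measurableTypeR R * measurableTypeR R] f.
  apply/measurable_EFinP; apply: measurable_funM.
    by apply: measurable_funM => //; exact: measurableT_comp mW measurable_fst.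
  apply: measurable_funM; first exact: measurableT_comp mHn measurable_snd.
  apply: measurableT_comp mkn _.
  by apply: measurable_funB; [exact: measurable_fst|exact: measurable_snd].
have convE t : (\int[lebesgue_measure]_r f (t, r) =
    (C * W t)%:E * ((w t)%:E * \int[lebesgue_measure]_s (H (t - s)%R * kappa s)%:E))%E.
  have mg : measurable_fun [set: R] (fun s => Hn (t - s) * kn s).
    by apply: measurable_funM => //; exact: measurableT_comp mHn (msub t).
  under eq_integral do rewrite /f EFinM /=.
  rewrite ge0_integralZl_EFin//; last 3 first.
  - by move=> r _; rewrite lee_fin mulr_ge0.
  - apply/measurable_EFinP; apply: measurable_funM => //.
    exact: measurableT_comp mkn (msub t).
  - exact: mulr_ge0.
  congr (_ * _)%E; rewrite -ge0_integralZl_EFin//; last 2 first.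
  - by move=> r _; rewrite lee_fin mulr_ge0.
  - apply/measurable_EFinP; apply: measurable_funM => //.
    exact: measurableT_comp mH (msub t).
  transitivity (\int[lebesgue_measure]_s (Hn (t - s)%R * kn s)%:E)%E.
    rewrite -(@ge0_integral_reflect _ t (fun s => (Hn (t - s) * kn s)%:E)).
    - by apply: eq_integral => r _; congr (EFin (Hn _ * _)); ring.
    - exact/measurable_EFinP.
    - by move=> s; rewrite lee_fin mulr_ge0.
  apply: eq_integral => s _; rewrite -EFinM; congr EFin.
  by rewrite /Hn /kn -(wD s t); ring.
have HnW : {ae @lebesgue_measure R, forall t, ((Hn t)%:E <=
    \int[lebesgue_measure]_r f (t, r))%E}.
  apply: filterS HW; first exact: (ae_filter_ringOfSetsType lebesgue_measure).
  move=> t Ht; rewrite convE muleCA /Hn EFinM.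
  by apply: lee_pmul => //; rewrite lee_fin.
(* With [t = s + r] the factor [W] becomes a translate with the same integral of the square; this is
   why [n] had to be uniform in [V]. *)
have inner r : (\int[lebesgue_measure]_t f (t, r) <= (2^-1)%:E * (Hn r)%:E)%E.
  have mWr : measurable_fun [set: R] (fun s => W (s - - r)).
    by apply: measurableT_comp mW _; exact: measurable_funB.
  have mV : measurable_fun [set: R] (fun s => W (s - - r) * kn s) by exact: measurable_funM.
  have -> : (\int[lebesgue_measure]_t f (t, r) = (Hn r)%:E *
      (C%:E * \int[lebesgue_measure]_s (W (s - - r)%R * kn s)%:E))%E.
    rewrite -(@ge0_integral_shift _ r (fun s => (W (s - - r) * kn s)%:E)); last 2 first.
    - exact/measurable_EFinP.
    - by move=> s; rewrite lee_fin mulr_ge0.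
    have mVr : measurable_fun [set: R] (fun s => W (s - r - - r) * kn (s - r)).
      by apply: measurableT_comp mV _; exact: measurable_funB.
    rewrite -ge0_integralZl_EFin//; last 2 first.
    - by move=> s _; rewrite lee_fin mulr_ge0.
    - exact/measurable_EFinP.
    rewrite -ge0_integralZl_EFin//; last 2 first.
    - by move=> s _; rewrite -EFinM lee_fin !mulr_ge0.
    - by apply/measurable_EFinP; exact: measurable_funM.
    apply: eq_integral => t _; rewrite /f -!EFinM opprK subrK/=; congr EFin; ring.
  rewrite muleC lee_wpmul2r ?lee_fin//; apply: nsmall => //.
  have -> := @ge0_integral_shift _ (- r) (fun s => (W s ^+ 2)%:E).
  - by rewrite JE.
  - by apply/measurable_EFinP; exact: measurable_funX.
  - by move=> s; rewrite lee_fin sqr_ge0.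
have Hle : (\int[lebesgue_measure]_t (Hn t)%:E <=
    (2^-1)%:E * \int[lebesgue_measure]_t (Hn t)%:E)%E.
  rewrite -ge0_integralZl_EFin//; last 2 first.
  - by move=> t _; rewrite lee_fin.
  - exact/measurable_EFinP.
  apply: (@le_trans _ _ (\int[lebesgue_measure]_t \int[lebesgue_measure]_r f (t, r))%E).
    apply: ae_ge0_le_integral => //.
    - by move=> t _; rewrite lee_fin.
    - exact/measurable_EFinP.
    - by move=> t _; exact: integral_ge0.
    - exact: measurable_fun_fubini_tonelli_F.
    - apply: filterS HnW; first exact: (ae_filter_ringOfSetsType lebesgue_measure).
      by [].
  rewrite fubini_tonelli//; apply: ge0_le_integral => //.
  - by move=> r _; exact: integral_ge0.
  - exact: measurable_fun_fubini_tonelli_G.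
  - by apply/measurable_EFinP; exact: measurable_funM.
(* A nonnegative number that is at most half of itself vanishes, provided that it is finite. *)
have Hn_int0 : (\int[lebesgue_measure]_t (Hn t)%:E = 0)%E.
  have I0 : (0 <= \int[lebesgue_measure]_t (Hn t)%:E)%E.
    by apply: integral_ge0 => t _; rewrite lee_fin.
  have Ifin : (\int[lebesgue_measure]_t (Hn t)%:E)%E \is a fin_num by rewrite ge0_fin_numE.
  have := fine_ge0 I0; move: Hle; rewrite -{1 2 4}(fineK Ifin) -EFinM lee_fin => h1 h2.
  congr EFin; lra.
have Hae : ae_eq (@lebesgue_measure R) setT (EFin \o Hn) (cst 0%E).
  apply/ae_eq_integral_abs => //; first exact/measurable_EFinP.
  rewrite -Hn_int0; apply: eq_integral => t _.
  by rewrite /= ger0_norm.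
(* [H] vanishes only almost everywhere, but the convolution does not see null sets, so its value is
   [0] at every [t]. The reflection brings the argument of [H] back to [s]. *)
move=> t.
rewrite -[RHS](integral0 (@lebesgue_measure R) setT).
rewrite -(@ge0_integral_reflect _ t); last 2 first.
- apply/measurable_EFinP; apply: measurable_funM => //.
  exact: measurableT_comp mH (msub t).
- by move=> s; rewrite lee_fin mulr_ge0.
apply: ae_eq_integral => //.
- apply/measurable_EFinP; apply: measurable_funM.
    apply: measurableT_comp mH _.
    by apply: measurable_funB => //; exact: msub.
  exact: measurableT_comp mk (msub t).
apply: (@filterS _ _ (ae_filter_ringOfSetsType lebesgue_measure) _ _ _ Hae).
move=> s /(_ I) /= [] /eqP; rewrite mulf_eq0 gt_eqF ?expR_gt0//= => /eqP Hs _.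
have -> : t - (t - s) = s by ring.
by rewrite Hs mul0r.
Qed.

(** * Square integrability *)

(** Extension by zero, so that convolutions become integrals over the whole line, where reflections
    and translations are available. *)
Definition cutoff (R : realType) (T : R) (f : R -> R) (s : R) : R :=
  if 0 <= s <= T then f s else 0.

Lemma cutoffE (R : realType) (T : R) (f : R -> R) : cutoff T f = f \_ `[0, T].
Proof.
apply/funext => s; rewrite patchE /cutoff.
case: ifPn => h; first by rewrite mem_set//= in_itv.
by case: ifPn => //; rewrite inE/= in_itv/= (negbTE h).
Qed.

Lemma measurable_cutoff (R : realType) (T : R) (f : R -> R) :
  measurable_fun `[0, T] f -> measurable_fun [set: R] (cutoff T f).
Proof. by rewrite cutoffE => mf; apply: (measurable_restrictT f (measurable_itv `[0, T])).1. Qed.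

Lemma integral_cutoff (R : realType) (T : R) (f : R -> R) :
  (\int[lebesgue_measure]_s (cutoff T f s)%:E =
   \int[lebesgue_measure]_(s in `[0%R, T]) (f s)%:E)%E.
Proof.
rewrite [RHS]integral_mkcond; apply: eq_integral => s _.
rewrite cutoffE !patchE; by case: ifP.
Qed.

Lemma cutoff_ge0 (R : realType) (T : R) (f : R -> R) (s : R) :
  (forall s, 0 <= f s) -> 0 <= cutoff T f s.
Proof. by move=> f0; rewrite /cutoff; case: ifP. Qed.

Lemma cutoff_lt0 (R : realType) (T : R) (f : R -> R) (s : R) :
  s < 0 -> cutoff T f s = 0.
Proof. by move=> s0; rewrite /cutoff leNgt s0. Qed.

Lemma cutoff_id (R : realType) (T : R) (f : R -> R) (s : R) :
  0 <= s <= T -> cutoff T f s = f s.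
Proof. by rewrite /cutoff => ->. Qed.

Lemma L2norm_lty (R : realType) (A : set R) (f : R -> R) :
  (L2norm A f < +oo)%E <->
  (\int[lebesgue_measure]_(s in A) (f s ^+ 2)%:E < +oo)%E.
Proof.
have -> : (L2norm A f =
    (\int[lebesgue_measure]_(s in A) (f s ^+ 2)%:E) `^ 2^-1)%E.
  rewrite /L2norm unlock; congr (_ `^ _)%E.
  rewrite [RHS]integral_mkcond; apply: eq_integral => s _.
  rewrite !patchE; case: ifPn => _ /=.
    by rewrite powR_mulrn// real_normK// num_real.
  by rewrite normr0 powR0.
split; last exact: poweR_lty.
have : (0 <= \int[lebesgue_measure]_(s in A) (f s ^+ 2)%:E)%E.
  by apply: integral_ge0 => s _; rewrite lee_fin sqr_ge0.
case: (integral _ _ _) => [r|_|//]; first by move=> *; exact: ltry.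
by rewrite poweRyr// invr_eq0 pnatr_eq0.
Qed.

(** The l^1 norm replaces [enorm] in all estimates because sums of absolute values over the
    coordinates commute with integrals. The two norms are equivalent, with constants [1] and [d]. *)
Definition norm1 (R : realType) (d : nat) (u : 'rV[R]_d) : R :=
  \sum_i `|u ord0 i|.

Lemma norm1_ge0 (R : realType) (d : nat) (u : 'rV[R]_d) : 0 <= norm1 u.
Proof. by apply: sumr_ge0 => i _. Qed.

Lemma norm1_coord (R : realType) (d : nat) (u : 'rV[R]_d) i :
  `|u ord0 i| <= norm1 u.
Proof. by rewrite /norm1 (bigD1 i)//= lerDl sumr_ge0. Qed.

Lemma norm1_0 (R : realType) (d : nat) : norm1 (0 : 'rV[R]_d) = 0.
Proof. by rewrite /norm1 big1// => i _; rewrite mxE normr0. Qed.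

Lemma norm1_eq0 (R : realType) (d : nat) (u : 'rV[R]_d) : norm1 u = 0 -> u = 0.
Proof.
move=> u0; apply/rowP => i; apply/eqP; rewrite mxE -normr_le0 -u0.
exact: norm1_coord.
Qed.

Lemma norm1D (R : realType) (d : nat) (u v : 'rV[R]_d) :
  norm1 (u + v) <= norm1 u + norm1 v.
Proof.
rewrite /norm1 -big_split/=; apply: ler_sum => i _.
by rewrite mxE ler_normD.
Qed.

Lemma norm1N (R : realType) (d : nat) (u : 'rV[R]_d) : norm1 (- u) = norm1 u.
Proof. by apply: eq_bigr => i _; rewrite mxE normrN. Qed.

Lemma norm1_le_enorm (R : realType) (d : nat) (u : 'rV[R]_d) :
  norm1 u <= d%:R * enorm u.
Proof.
have s0 i : 0 <= u ord0 i ^+ 2 by exact: sqr_ge0.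
rewrite mulrC -[d%:R]/(_ *+ d) mulr_natr.
rewrite -[X in _ *+ X](card_ord d) -sumr_const; apply: ler_sum => i _.
rewrite -sqrtr_sqr ler_sqrt ?sumr_ge0// (bigD1 i)//= lerDl.
exact: sumr_ge0.
Qed.

Lemma enorm_le_norm1 (R : realType) (d : nat) (u : 'rV[R]_d) :
  enorm u <= norm1 u.
Proof.
rewrite -[leRHS]ger0_norm ?norm1_ge0// -sqrtr_sqr ler_sqrt ?sqr_ge0//.
rewrite expr2 {1}/norm1 mulr_suml; apply: ler_sum => i _.
by rewrite -[u _ _ ^+ 2]real_normK ?num_real// expr2 ler_wpM2l// norm1_coord.
Qed.

Lemma measurable_norm1 (R : realType) (d : nat) (A : set R) (psi : R -> 'rV[R]_d) :
  (forall i, measurable_fun A (fun t => psi t ord0 i)) ->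
  measurable_fun A (fun t => norm1 (psi t)).
Proof.
move=> mpsi; apply: measurable_sum => i.
exact: measurableT_comp.
Qed.

Lemma sqr_integral_scale (R : realType) (A : set R) (c : R) (f g : R -> R) :
  measurable A -> measurable_fun A f -> measurable_fun A g ->
  (forall s, A s -> 0 <= f s <= c * g s) ->
  (\int[lebesgue_measure]_(s in A) (g s ^+ 2)%:E < +oo)%E ->
  (\int[lebesgue_measure]_(s in A) (f s ^+ 2)%:E < +oo)%E.
Proof.
move=> mA mf mg fg gint.
apply: (@le_lt_trans _ _ ((c ^+ 2)%:E *
    \int[lebesgue_measure]_(s in A) (g s ^+ 2)%:E)%E).
  rewrite -ge0_integralZl_EFin ?sqr_ge0//; last 2 first.
  - by move=> s _; rewrite lee_fin sqr_ge0.
  - by apply/measurable_EFinP; exact: measurable_funX.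
  apply: ge0_le_integral => //.
  - by move=> s _; rewrite lee_fin sqr_ge0.
  - by apply/measurable_EFinP; exact: measurable_funX.
  - by apply/measurable_EFinP; apply: measurable_funM => //; exact: measurable_funX.
  - move=> s As; rewrite -EFinM lee_fin -exprMn.
    have /andP[f0 fgs] := fg s As.
    by rewrite lerXn2r// nnegrE (le_trans f0).
by rewrite lte_mul_pinfty// lee_fin sqr_ge0.
Qed.

Lemma vec_L2P (R : realType) (d : nat) (A : set R) (psi : R -> 'rV[R]_d) :
  measurable A -> (forall i, measurable_fun A (fun t => psi t ord0 i)) ->
  (L2norm A (fun t => enorm (psi t)) < +oo)%E <->
  (\int[lebesgue_measure]_(t in A) (norm1 (psi t) ^+ 2)%:E < +oo)%E.
Proof.
move=> mA mpsi; have mn1 := @measurable_norm1 _ _ _ _ mpsi.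
have men : measurable_fun A (fun t => enorm (psi t)).
  apply: measurableT_comp; first by apply: continuous_measurable_fun; exact: sqrt_continuous.
  by apply: measurable_sum => i; exact: measurable_funX.
rewrite L2norm_lty; split; last first.
  apply: (@sqr_integral_scale _ _ 1) => // s _.
  by rewrite mul1r sqrtr_ge0 enorm_le_norm1.
apply: (@sqr_integral_scale _ _ d%:R) => // s _.
by rewrite norm1_ge0 norm1_le_enorm.
Qed.

(** * The Volterra equation *)

Definition volterra_at (R : realType) (d : nat) (G : 'rV[R]_d -> 'rV[R]_d)
    (k : 'I_d -> R -> R) (psi : R -> 'rV[R]_d) (t : R) : Prop :=
  forall i, (@lebesgue_measure R).-integrable `[0, t]
      (EFin \o (fun s => G (psi (t - s)) ord0 i * k i s)) /\
    psi t ord0 i = \int[lebesgue_measure]_(s in `[0, t])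
      (G (psi (t - s)) ord0 i * k i s).

Lemma solves_at_diagP (R : realType) (d : nat) (G : 'rV[R]_d -> 'rV[R]_d)
    (k : 'I_d -> R -> R) (psi : R -> 'rV[R]_d) (t : R) :
  solves_at G (fun s => diag_mx (\row_i k i s)) psi t <-> volterra_at G k psi t.
Proof.
have E i s : (G (psi (t - s)) *m diag_mx (\row_i k i s)) ord0 i =
    G (psi (t - s)) ord0 i * k i s by rewrite mul_mx_diag !mxE.
rewrite /solves_at /volterra_at; split=> [[intE psiE] i|H].
  split; first by have := intE i; apply: eq_integrable => // s _ /=; rewrite E.
  by rewrite psiE mxE; apply: eq_Rintegral => s _; rewrite E.
split=> [i|].
  by have [+ _] := H i; apply: eq_integrable => // s _ /=; rewrite E.
apply/rowP => i; rewrite mxE (H i).2.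
by apply: eq_Rintegral => s _; rewrite E.
Qed.

(** The common source of the uniqueness estimate, of the contraction property and, with [g = 0], of
    bounds on a single convolution. The right-hand side is an extended real, so the integrability of
    [h * kappa] is left open here. *)
Lemma convolution_diff_le (R : realType) (d : nat) (k f g : 'I_d -> R -> R)
    (h kappa : R -> R) (t : R) :
  (forall i, (@lebesgue_measure R).-integrable `[0, t] (EFin \o (fun s => f i s * k i s))) ->
  (forall i, (@lebesgue_measure R).-integrable `[0, t] (EFin \o (fun s => g i s * k i s))) ->
  measurable_fun [set: R] h -> measurable_fun [set: R] kappa ->
  (forall s, 0 <= h s) -> (forall s, 0 <= kappa s) ->
  (forall i s, 0 <= s <= t -> `|f i s - g i s| <= h s) ->
  (forall s, 0 <= s <= t -> \sum_i `|k i s| <= kappa s) ->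
  ((\sum_i `| \int[lebesgue_measure]_(s in `[0, t]) (f i s * k i s) -
      \int[lebesgue_measure]_(s in `[0, t]) (g i s * k i s)|)%:E <=
   \int[lebesgue_measure]_s (h s * kappa s)%:E)%E.
Proof.
move=> fint gint mh mk h0 k0 fgh kk.
have mI : measurable (`[0, t] : set (measurableTypeR R)) by exact: measurable_itv.
pose D i s := f i s * k i s - g i s * k i s.
have Dint i : (@lebesgue_measure R).-integrable `[0, t] (EFin \o D i).
  have := integrableB mI (fint i) (gint i).
  by apply: eq_integrable => // s _.
have mD i : measurable_fun `[0, t] (D i) by apply/measurable_EFinP; exact: measurable_int (Dint i).
rewrite -sumEFin.
under eq_bigr => i _ do rewrite -(RintegralB mI (fint i) (gint i)) (EFin_normr_Rintegral mI (Dint i)).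
apply: (@le_trans _ _ (\sum_i \int[lebesgue_measure]_(s in `[0%R, t]) `|D i s|%:E)%E).
  apply: lee_sum => i _; apply: le_abse_integral => //.
  by apply/measurable_EFinP; exact: mD.
rewrite -ge0_integral_sum//; last first.
  move=> i; apply/measurable_EFinP; exact: measurableT_comp (@normr_measurable R setT) (mD i).
apply: (@le_trans _ _ (\int[lebesgue_measure]_(s in `[0%R, t]) (h s * kappa s)%:E)%E).
  apply: ge0_le_integral => //.
  - by move=> s _; apply: sume_ge0.
  - apply: emeasurable_sum => i; apply/measurable_EFinP.
    exact: measurableT_comp (@normr_measurable R setT) (mD i).
  - apply/measurable_EFinP; apply: measurable_funS (measurable_funM mh mk) => //.
  move=> s /=; rewrite in_itv/= => st.
  rewrite sumEFin lee_fin.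
  apply: (@le_trans _ _ (\sum_i h s * `|k i s|)).
    apply: ler_sum => i _; rewrite /D -mulrBl normrM ler_wpM2r//.
    exact: fgh.
  by rewrite -mulr_sumr ler_wpM2l// kk.
apply: ge0_subset_integral => //.
- by apply/measurable_EFinP; exact: measurable_funM.
- by move=> s _; rewrite lee_fin mulr_ge0.
Qed.

Definition kernel_bound (R : realType) (d : nat) (k : 'I_d -> R -> R) (T : R) : R -> R :=
  cutoff T (fun s => norm1 (\row_i k i s)).

Lemma kernel_bound_ge0 (R : realType) (d : nat) (k : 'I_d -> R -> R) (T s : R) :
  0 <= kernel_bound k T s.
Proof. by apply: cutoff_ge0 => t; exact: norm1_ge0. Qed.

Lemma kernel_boundE (R : realType) (d : nat) (k : 'I_d -> R -> R) (T s : R) :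
  0 <= s <= T -> \sum_i `|k i s| = kernel_bound k T s.
Proof. by move=> sT; rewrite /kernel_bound cutoff_id//; apply: eq_bigr => i _; rewrite mxE. Qed.

Lemma measurable_kernel_bound (R : realType) (d : nat) (k : 'I_d -> R -> R) (T : R) :
  0 < T -> (forall i, L2loc (k i)) -> measurable_fun [set: R] (kernel_bound k T).
Proof.
move=> T0 hk; apply: measurable_cutoff; apply: measurable_norm1 => i.
have -> : (fun t => (\row_i k i t : 'rV[R]_d) ord0 i) = k i.
  by apply/funext => s; rewrite mxE.
by have [] := hk i T T0.
Qed.

Lemma kernel_bound_sqr_integral (R : realType) (d : nat) (k : 'I_d -> R -> R) (T : R) :
  0 < T -> (forall i, L2loc (k i)) ->
  (\int[lebesgue_measure]_s (kernel_bound k T s ^+ 2)%:E < +oo)%E.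
Proof.
move=> T0 hk.
have mI : measurable (`[0, T] : set (measurableTypeR R)) by exact: measurable_itv.
have mk i : measurable_fun `[0, T] (fun s => (\row_i k i s : 'rV[R]_d) ord0 i).
  have -> : (fun s => (\row_i k i s : 'rV[R]_d) ord0 i) = k i.
    by apply/funext => s; rewrite mxE.
  by have [] := hk i T T0.
have -> : (fun s => (kernel_bound k T s ^+ 2)%:E) =
    (fun s => (cutoff T (fun s => norm1 (\row_i k i s) ^+ 2) s)%:E).
  apply/funext => s; congr EFin; rewrite /kernel_bound /cutoff.
  by case: ifP => //; rewrite expr0n.
(* The square of [norm1] has mixed terms; that of [enorm] is a plain sum of squares, one for each
   [k i]. *)
rewrite integral_cutoff; apply/vec_L2P => //; apply/L2norm_lty.
have -> : (\int[lebesgue_measure]_(s in `[0%R, T]) (enorm (\row_i k i s) ^+ 2)%:E =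
    \sum_i \int[lebesgue_measure]_(s in `[0%R, T]) (k i s ^+ 2)%:E)%E.
  rewrite -ge0_integral_sum//.
  - apply: eq_integral => s _; rewrite /enorm sqr_sqrtr ?sumr_ge0// => [|i _].
      by rewrite sumEFin; congr EFin; apply: eq_bigr => i _; rewrite mxE.
    by rewrite sqr_ge0.
  - by move=> i; apply/measurable_EFinP/measurable_funX; have [] := hk i T T0.
  - by move=> i s _; rewrite lee_fin sqr_ge0.
apply: lte_sum_pinfty => i _; apply/L2norm_lty.
by have [] := hk i T T0.
Qed.

(** * Uniqueness *)

(** A local Lipschitz condition whose constant grows linearly, as for a quadratic polynomial. With
    [v = 0] it gives quadratic growth. *)
Definition quad_lipschitz (R : realType) (d : nat) (C : R)
    (G : 'rV[R]_d -> 'rV[R]_d) : Prop :=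
  forall u v i, `|G u ord0 i - G v ord0 i| <=
    C * (norm1 (u - v) * (1 + norm1 u + norm1 v)).

(** The equations almost everywhere suffice to make the convolution of [H] vanish at every time. The
    equations at the particular [t] then turn this into equality at [t]. *)
Lemma volterra_unique (R : realType) (d : nat) (G : 'rV[R]_d -> 'rV[R]_d)
    (k : 'I_d -> R -> R) (C T : R) (phi psi : R -> 'rV[R]_d) :
  0 < T -> 0 <= C -> quad_lipschitz C G -> (forall i, L2loc (k i)) ->
  vec_L2 `[0, T] phi -> vec_L2 `[0, T] psi ->
  {ae @lebesgue_measure R, forall t, 0 <= t <= T ->
    volterra_at G k phi t /\ volterra_at G k psi t} ->
  forall t, 0 <= t <= T -> volterra_at G k phi t -> volterra_at G k psi t ->
  phi t = psi t.
Proof.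
move=> T0 C0 GC hk [mphi phi2] [mpsi psi2] ae_sol.
have mI : measurable (`[0, T] : set (measurableTypeR R)) by exact: measurable_itv.
pose delta t := norm1 (phi t - psi t).
pose w t := 1 + norm1 (phi t) + norm1 (psi t).
have delta0 t : 0 <= delta t by exact: norm1_ge0.
have w0 t : 0 <= w t by rewrite !addr_ge0 ?norm1_ge0.
have mnphi := @measurable_norm1 _ _ _ _ mphi.
have mnpsi := @measurable_norm1 _ _ _ _ mpsi.
have mw : measurable_fun `[0, T] w.
  by apply: measurable_funD => //; exact: measurable_funD.
have mdelta : measurable_fun `[0, T] delta.
  apply: measurable_norm1 => i.
  have -> : (fun t => (phi t - psi t) ord0 i) = (fun t => phi t ord0 i - psi t ord0 i).
    by apply/funext => t; rewrite !mxE.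
  exact: measurable_funB.
(* By [quad_lipschitz] the estimate of [delta] has [delta * w] under the integral, not [delta];
   multiplying it by [w] puts the same function on both sides. *)
pose W := cutoff T w; pose H := cutoff T (fun t => delta t * w t).
pose kappa := kernel_bound k T.
have mH : measurable_fun [set: R] H by apply: measurable_cutoff; exact: measurable_funM.
have mW : measurable_fun [set: R] W by exact: measurable_cutoff.
have mk : measurable_fun [set: R] kappa by exact: measurable_kernel_bound.
have H0 t : 0 <= H t by apply: cutoff_ge0 => s; exact: mulr_ge0.
have W0 t : 0 <= W t by exact: cutoff_ge0.
have k0 t : 0 <= kappa t by exact: kernel_bound_ge0.
have est t : 0 <= t <= T -> volterra_at G k phi t -> volterra_at G k psi t ->
    ((delta t)%:E <= C%:E * \int[lebesgue_measure]_s (H (t - s)%R * kappa s)%:E)%E.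
  move=> /andP[t0 tT] sphi spsi.
  have msub : measurable_fun [set: R] (fun s : R => t - s) by exact: measurable_funB.
  have mHt : measurable_fun [set: R] (fun s => H (t - s)) by exact: measurableT_comp mH msub.
  rewrite -ge0_integralZl_EFin//; last 2 first.
  - by move=> s _; rewrite lee_fin mulr_ge0.
  - by apply/measurable_EFinP; exact: measurable_funM.
  under eq_integral do rewrite -EFinM mulrA.
  have -> : delta t = \sum_i `| \int[lebesgue_measure]_(s in `[0, t])
        (G (phi (t - s)) ord0 i * k i s) -
      \int[lebesgue_measure]_(s in `[0, t]) (G (psi (t - s)) ord0 i * k i s)|.
    by apply: eq_bigr => i _; rewrite !mxE (sphi i).2 (spsi i).2.
  apply: (@convolution_diff_le R d k (fun i s => G (phi (t - s)) ord0 i)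
    (fun i s => G (psi (t - s)) ord0 i)) => //.
  - by move=> i; exact: (sphi i).1.
  - by move=> i; exact: (spsi i).1.
  - exact: measurable_funM.
  - by move=> s; exact: mulr_ge0.
  - move=> i s /andP[s0 st]; rewrite /H cutoff_id; first exact: GC.
    by apply/andP; split; lra.
  - move=> s /andP[s0 st]; rewrite (@kernel_boundE _ _ _ T)//.
    by rewrite s0 (le_trans st).
have Wint : (\int[lebesgue_measure]_t (W t ^+ 2)%:E < +oo)%E.
  have -> : (fun t => (W t ^+ 2)%:E) = (fun t => (cutoff T (fun t => w t ^+ 2) t)%:E).
    by apply/funext => t; rewrite /W /cutoff; case: ifP => //; rewrite expr0n.
  rewrite integral_cutoff.
  (* Cauchy-Schwarz for a sum of three terms. *)
  have bnd t : w t ^+ 2 <= 3 * (1 + (norm1 (phi t) ^+ 2 + norm1 (psi t) ^+ 2)).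
    rewrite /w; set a := norm1 _; set b := norm1 _.
    have := sqr_ge0 (a - b); have := sqr_ge0 (a - 1); have := sqr_ge0 (b - 1).
    by rewrite !expr2; nra.
  have mq (f : R -> R) : measurable_fun `[0, T] f -> measurable_fun `[0, T] (fun t => f t ^+ 2).
    by move=> mf; exact: measurable_funX.
  have mr : measurable_fun `[0, T] (fun t => norm1 (phi t) ^+ 2 + norm1 (psi t) ^+ 2).
    by apply: measurable_funD; exact: mq.
  have r0 t : 0 <= norm1 (phi t) ^+ 2 + norm1 (psi t) ^+ 2 by rewrite addr_ge0 ?sqr_ge0.
  apply: (@le_lt_trans _ _ (\int[lebesgue_measure]_(t in `[0%R, T])
      (3 * (1 + (norm1 (phi t) ^+ 2 + norm1 (psi t) ^+ 2)))%:E)%E).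
    apply: ge0_le_integral => //.
    - by move=> t _; rewrite lee_fin sqr_ge0.
    - by apply/measurable_EFinP; exact: mq.
    - by apply/measurable_EFinP; apply: measurable_funM => //; exact: measurable_funD.
    - by move=> t _; rewrite lee_fin.
  under eq_integral do rewrite EFinM.
  rewrite ge0_integralZl_EFin//; last 2 first.
  - by move=> t _; rewrite lee_fin addr_ge0.
  - by apply/measurable_EFinP; exact: measurable_funD.
  rewrite lte_mul_pinfty//.
  under eq_integral do rewrite EFinD EFinD.
  rewrite ge0_integralD//; last 2 first.
  - by move=> t _; rewrite adde_ge0// lee_fin sqr_ge0.
  - by apply: emeasurable_funD; apply/measurable_EFinP; exact: mq.
  rewrite ge0_integralD//; last 4 first.
  - by move=> t _; rewrite lee_fin sqr_ge0.
  - by apply/measurable_EFinP; exact: mq.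
  - by move=> t _; rewrite lee_fin sqr_ge0.
  - by apply/measurable_EFinP; exact: mq.
  apply: lte_add_pinfty; last apply: lte_add_pinfty.
  - rewrite [ltLHS](_ : _ = (1 * lebesgue_measure (`[0%R, T] : set R))%E); last exact: integral_cst.
    rewrite mul1e lebesgue_measure_itv/= lte_fin T0.
    by rewrite -EFinB ltry.
  - exact/vec_L2P.
  - exact/vec_L2P.
have kint : (\int[lebesgue_measure]_s (kappa s ^+ 2)%:E < +oo)%E.
  exact: kernel_bound_sqr_integral.
(* Since [delta <= w], the function [H] is at most [W ^+ 2]. *)
have Hint : (\int[lebesgue_measure]_t (H t)%:E < +oo)%E.
  apply: le_lt_trans Wint; apply: ge0_le_integral => //.
  - by move=> t _; rewrite lee_fin.
  - exact/measurable_EFinP.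
  - by apply/measurable_EFinP; exact: measurable_funX.
  move=> t _; rewrite lee_fin /H /W /cutoff; case: ifP => _; last by rewrite expr0n.
  rewrite expr2 ler_wpM2r// /delta /w.
  apply: le_trans (norm1D _ _) _; rewrite norm1N.
  by rewrite -addrA lerDr.
have HW : {ae @lebesgue_measure R, forall t, ((H t)%:E <=
     (C * W t)%:E * \int[lebesgue_measure]_s (H (t - s)%R * kappa s)%:E)%E}.
  apply: (@filterS _ _ (ae_filter_ringOfSetsType lebesgue_measure) _ _ _ ae_sol).
  move=> t sol; have I0 : (0 <= \int[lebesgue_measure]_s (H (t - s)%R * kappa s)%:E)%E.
    by apply: integral_ge0 => s _; rewrite lee_fin mulr_ge0.
  have [tT|tT] := boolP (0 <= t <= T); last first.
    by rewrite /H /cutoff (negbTE tT) mule_ge0// lee_fin mulr_ge0.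
  have [s1 s2] := sol tT.
  rewrite /W [in leRHS]mulrC EFinM -muleA /H cutoff_id// mulrC EFinM cutoff_id//.
  by rewrite lee_wpmul2l// ?lee_fin//; exact: est.
move=> t tT sphi spsi.
have := est t tT sphi spsi.
rewrite (@volterra_ineq_null R C H W kappa)//; last 2 first.
- by move=> s; exact: cutoff_lt0.
- by move=> s; exact: cutoff_lt0.
rewrite mule0 lee_fin => dt0.
apply/eqP; rewrite -subr_eq0; apply/eqP/norm1_eq0/eqP.
by rewrite eq_le dt0 norm1_ge0.
Qed.

(** * Convolutions *)

(** On an interval of finite length the bound [|f| <= 1 + f ^+ 2] is enough. *)
Lemma cutoff_integrable (R : realType) (T : R) (f : R -> R) :
  0 < T -> measurable_fun `[0, T] f ->
  (\int[lebesgue_measure]_(s in `[0%R, T]) (f s ^+ 2)%:E < +oo)%E ->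
  (@lebesgue_measure R).-integrable [set: R] (EFin \o cutoff T f).
Proof.
move=> T0 mf f2.
have mI : measurable (`[0, T] : set (measurableTypeR R)) by exact: measurable_itv.
have mf2 : measurable_fun `[0, T] (fun s => f s ^+ 2) by exact: measurable_funX.
apply/integrableP; split; first by apply/measurable_EFinP; exact: measurable_cutoff.
apply: (@le_lt_trans _ _ (\int[lebesgue_measure]_s (cutoff T (fun s => 1 + f s ^+ 2) s)%:E)%E).
  apply: ge0_le_integral => //.
  - apply: (measurableT_comp (@abse_measurable R setT)).
    by apply/measurable_EFinP; exact: measurable_cutoff.
  - by apply/measurable_EFinP; apply: measurable_cutoff; exact: measurable_funD.
  move=> s _ /=; rewrite lee_fin /cutoff; case: ifP => _; last by rewrite normr0.
  have := sqr_ge0 (`|f s| - 1); rewrite -[f s ^+ 2]real_normK ?num_real//.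
  by rewrite !expr2; nra.
rewrite integral_cutoff; under eq_integral do rewrite EFinD.
rewrite ge0_integralD//; last 2 first.
- by move=> s _; rewrite lee_fin sqr_ge0.
- exact/measurable_EFinP.
apply: lte_add_pinfty => //.
rewrite [ltLHS](_ : _ = (1 * lebesgue_measure (`[0%R, T] : set R))%E); last exact: integral_cst.
by rewrite mul1e lebesgue_measure_itv/= lte_fin T0 -EFinB ltry.
Qed.

Lemma primitive_continuous (R : realType) (f : R -> R) :
  (@lebesgue_measure R).-integrable [set: R] (EFin \o f) ->
  (forall s, s < 0 -> f s = 0) ->
  continuous (fun t : R => \int[lebesgue_measure]_(s in `[0, t]) f s).
Proof.
move=> fint fneg t0.
(* Moving the lower end from [0] to a negative [a] changes nothing, as [f] vanishes there, and
   places [t0] in the interior of [[a, b]]; continuity at [t0] is then two-sided even for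
   [t0 <= 0]. *)
pose a : R := - (`|t0| + 1); pose b : R := `|t0| + 1.
have at0 : a < t0 by rewrite ltrNl (le_lt_trans (ler_norm _))// normrN ltrDl.
have t0b : t0 < b by rewrite (le_lt_trans (ler_norm _))// ltrDl.
have a0 : a < 0 by rewrite oppr_lt0 ltr_wpDl.
have fab : (@lebesgue_measure R).-integrable `[a, b] (EFin \o f).
  by apply: integrableS fint.
have -> : (fun t : R => \int[lebesgue_measure]_(s in `[0, t]) f s) =
    (fun t : R => \int[lebesgue_measure]_(s in `[a, t]) f s).
  apply/funext => t; rewrite Rintegral_mkcond [RHS]Rintegral_mkcond.
  apply: eq_Rintegral => s _; rewrite !patchE.
  case: ifPn.
    rewrite inE/= in_itv/= => /andP[s0 st]; rewrite mem_set//= in_itv/= st andbT.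
    by rewrite (le_trans (ltW a0)).
  rewrite notin_setE/= in_itv/= => /negP h; case: ifPn => //; rewrite inE/= in_itv/= => /andP[sa st].
  by rewrite fneg// ltNge; apply: contra h => ->; rewrite st.
have := parameterized_integral_continuous (ltW (lt_trans at0 t0b)) fab.
rewrite continuous_within_itvP ?(lt_trans at0)// => -[+ _ _].
by apply; rewrite in_itv/= at0.
Qed.

(** As [g] vanishes on the negative half-line, the integral extends to the whole line and the moving
    end point disappears. What remains is dominated convergence with [B * |f|]. *)
Lemma convolution_continuous (R : realType) (g f : R -> R) (B : R) :
  (@lebesgue_measure R).-integrable [set: R] (EFin \o f) ->
  (forall s, s < 0 -> f s = 0) ->
  continuous g -> (forall s, `|g s| <= B) -> (forall s, s <= 0 -> g s = 0) ->
  continuous (fun t : R => \int[lebesgue_measure]_(s in `[0, t]) (g (t - s) * f s)).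
Proof.
move=> fint fneg cg gB gneg.
have B0 : 0 <= B by apply: le_trans (gB 0).
have mf : measurable_fun [set: R] f by apply/measurable_EFinP; exact: measurable_int fint.
have -> : (fun t : R => \int[lebesgue_measure]_(s in `[0, t]) (g (t - s) * f s)) =
    (fun t : R => \int[lebesgue_measure]_s (g (t - s) * f s)).
  apply/funext => t; rewrite Rintegral_mkcond.
  apply: eq_Rintegral => s _; rewrite !patchE.
  case: ifPn => //; rewrite notin_setE/= in_itv/= => /negP.
  rewrite negb_and -!ltNge => /orP[s0|st]; first by rewrite fneg// mulr0.
  by rewrite gneg ?mul0r// subr_le0 ltW.
have mg : measurable_fun [set: R] g by exact: continuous_measurable_fun.
have dom t s : `|g (t - s) * f s| <= B * `|f s| by rewrite normrM ler_wpM2r.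
have mgt t : measurable_fun [set: R] (fun s => g (t - s) * f s).
  by apply: measurable_funM => //; apply: measurableT_comp mg _; exact: measurable_funB.
have Bfint : (@lebesgue_measure R).-integrable [set: R] (EFin \o (fun s => B * `|f s|)).
  have := integrableZl measurableT B (integrable_norm fint).
  by apply: eq_integrable.
move=> t0.
apply: (@continuity_under_integral R _ (measurableTypeR R) lebesgue_measure
  (fun t s => g (t - s) * f s) setT measurableT (t0 - 1) (t0 + 1) _ _ (fun s => B * `|f s|)).
- move=> t _; apply: le_integrable Bfint => //.
    by apply/measurable_EFinP; exact: mgt.
  move=> s _ /=; rewrite lee_fin [leRHS]ger0_norm ?mulr_ge0//.
- apply: aeW => s _ t _; apply: cvgMl.
  apply: (@continuous_comp _ _ _ (fun t : R => t - s) g); last exact: cg.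
  by apply: cvgB; [exact: cvg_id|exact: cvg_cst].
- exact: Bfint.
- by move=> t _; apply: aeW => s _.
- by rewrite inE/= in_itv/=; apply/andP; split; lra.
Qed.

(** * Picard iteration for a bounded Lipschitz nonlinearity *)

(** Continuity is required on all of [R]: the constructed solutions vanish for [t <= 0], which
    avoids subspace topologies until the maximal solution. *)
Definition coordwise_continuous (R : realType) (d : nat) (x : R -> 'rV[R]_d) : Prop :=
  forall i, continuous (fun t => x t ord0 i).

Lemma norm1_continuous (R : realType) (d : nat) (x : R -> 'rV[R]_d) :
  coordwise_continuous x -> continuous (fun t => norm1 (x t)).
Proof.
move=> cx; rewrite /norm1; apply: continuous_big => [|i _ t].
  exact: add_continuous.
exact: (continuous_comp (cx i t) (@norm_continuous _ R^o _)).
Qed.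

Lemma coordwise_continuousB (R : realType) (d : nat) (x y : R -> 'rV[R]_d) :
  coordwise_continuous x -> coordwise_continuous y -> coordwise_continuous (fun t => x t - y t).
Proof.
move=> cx cy i t.
have -> : (fun t => (x t - y t) ord0 i) = (fun t => x t ord0 i - y t ord0 i).
  by apply/funext => s; rewrite !mxE.
by apply: cvgB; [exact: cx|exact: cy].
Qed.

Lemma coordwise_continuous_measurable (R : realType) (d : nat) (x : R -> 'rV[R]_d)
    (A : set R) : measurable A ->
  coordwise_continuous x -> forall i, measurable_fun A (fun t => x t ord0 i).
Proof.
move=> mA cx i; apply: (@measurable_funS _ _ _ _ setT) => //.
exact: continuous_measurable_fun.
Qed.

(** The kernel is cut off at [T] to be integrable on the whole line; on [[0, T]] the equation is
    unchanged. *)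
Definition picard (R : realType) (d : nat) (G : 'rV[R]_d -> 'rV[R]_d)
    (k : 'I_d -> R -> R) (T : R) (x : R -> 'rV[R]_d) (t : R) : 'rV[R]_d :=
  \row_i \int[lebesgue_measure]_(s in `[0, t])
    (G (x (t - s)) ord0 i * cutoff T (k i) s).

Section Picard.
Context (R : realType) (d : nat) (G : 'rV[R]_d -> 'rV[R]_d).
Context (k : 'I_d -> R -> R) (T L B : R).
Hypothesis (T0 : 0 < T) (hk : forall i, L2loc (k i)) (L0 : 0 <= L).
Hypothesis GL : forall u v i, `|G u ord0 i - G v ord0 i| <= L * norm1 (u - v).
Hypothesis GB : forall u i, `|G u ord0 i| <= B.

Lemma lipschitz_comp_continuous (x : R -> 'rV[R]_d) :
  coordwise_continuous x -> forall i, continuous (fun t => G (x t) ord0 i).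
Proof.
move=> cx i t0.
have c : (fun t => L * norm1 (x t0 - x t)) t @[t --> t0] --> L * norm1 (x t0 - x t0).
  apply: cvgMr; apply: (@norm1_continuous R d (fun t => x t0 - x t)).
  by apply: coordwise_continuousB => // j; exact: cst_continuous.
apply/cvgrPdist_lt => e e0.
have : \forall t \near t0, L * norm1 (x t0 - x t) < e.
  by apply: cvgr_lt c _ _; rewrite subrr norm1_0 mulr0.
by apply: filterS => t; apply: le_lt_trans; exact: GL.
Qed.

Lemma picard_kernel_integrable i :
  (@lebesgue_measure R).-integrable [set: R] (EFin \o cutoff T (k i)).
Proof.
have [mk k2] := hk i T0; apply: cutoff_integrable => //; exact/L2norm_lty.
Qed.

Lemma measurable_picard_kernel i : measurable_fun [set: R] (cutoff T (k i)).
Proof. by have [mk _] := hk i T0; exact: measurable_cutoff. Qed.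

Lemma picard_integrable (x : R -> 'rV[R]_d) (t : R) i : coordwise_continuous x ->
  (@lebesgue_measure R).-integrable `[0, t]
    (EFin \o (fun s => G (x (t - s)) ord0 i * cutoff T (k i) s)).
Proof.
move=> cx.
have mGx : measurable_fun [set: R] (fun s => G (x s) ord0 i).
  by apply: continuous_measurable_fun; exact: lipschitz_comp_continuous.
have mk := measurable_picard_kernel i.
apply: (@integrableS _ (measurableTypeR R) _ _ setT) => //.
apply: (@le_integrable _ (measurableTypeR R) _ _ setT _ _
  (fun s => B%:E * (EFin \o cutoff T (k i)) s)%E) => //.
- apply/measurable_EFinP; apply: measurable_funM => //.
  by apply: measurableT_comp mGx _; exact: measurable_funB.
- move=> s _ /=; rewrite lee_fin !normrM ler_wpM2r//.
  by rewrite (le_trans (GB _ _))// ler_norm.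
- by apply: integrableZl => //; exact: picard_kernel_integrable.
Qed.

Lemma picard_le0 (x : R -> 'rV[R]_d) (t : R) : t <= 0 -> picard G k T x t = 0.
Proof.
rewrite le_eqVlt => t0; apply/rowP => i; rewrite !mxE.
case/predU1P: t0 => [->|t0]; first by rewrite set_itv1 Rintegral_set1.
by rewrite set_itv_ge ?Rintegral_set0// bnd_simp -ltNge.
Qed.

Lemma picard_continuous (x : R -> 'rV[R]_d) :
  coordwise_continuous x -> (forall t, t <= 0 -> x t = 0) ->
  coordwise_continuous (picard G k T x).
Proof.
move=> cx x0 i.
have kint := picard_kernel_integrable i.
have kneg s : s < 0 -> cutoff T (k i) s = 0 by exact: cutoff_lt0.
(* Subtracting [G 0] makes the function vanish for [t <= 0], as [convolution_continuous] demands;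
   the constant contributes a multiple of a primitive of the kernel. *)
pose g t := G (x t) ord0 i - G 0 ord0 i.
have cg : continuous g.
  by move=> t; apply: cvgB; [exact: lipschitz_comp_continuous|exact: cvg_cst].
have -> : (fun t => picard G k T x t ord0 i) = (fun t =>
    \int[lebesgue_measure]_(s in `[0, t]) (g (t - s) * cutoff T (k i) s) +
    G 0 ord0 i * \int[lebesgue_measure]_(s in `[0, t]) (cutoff T (k i) s)).
  apply/funext => t; rewrite mxE.
  have mI : measurable (`[0, t] : set (measurableTypeR R)) by exact: measurable_itv.
  have kI : (@lebesgue_measure R).-integrable `[0, t] (EFin \o cutoff T (k i)).
    exact: integrableS kint.
  have kI0 : (@lebesgue_measure R).-integrable `[0, t]
      (EFin \o (fun s => G 0 ord0 i * cutoff T (k i) s)).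
    by have := integrableZl mI (G 0 ord0 i) kI; exact: eq_integrable.
  have gI : (@lebesgue_measure R).-integrable `[0, t]
      (EFin \o (fun s => g (t - s) * cutoff T (k i) s)).
    have := integrableB mI (picard_integrable t i cx) kI0.
    by apply: eq_integrable => // s _; rewrite /= -EFinB -mulrBl.
  rewrite -RintegralZl// -RintegralD//.
  by apply: eq_Rintegral => s _; rewrite /g; ring.
move=> t; apply: cvgD.
  apply: (@convolution_continuous R g _ (B + B)) => //.
    by move=> s; rewrite /g (le_trans (ler_normB _ _))// lerD.
  by move=> s s0; rewrite /g x0// subrr.
by apply: cvgMr; exact: primitive_continuous.
Qed.

Lemma kernel_bound_integral :
  (\int[lebesgue_measure]_s (kernel_bound k T s)%:E < +oo)%E.
Proof.
have mkb : measurable_fun `[0, T] (fun s => norm1 (\row_i k i s)).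
  apply: measurable_norm1 => i.
  have -> : (fun t => (\row_i k i t : 'rV[R]_d) ord0 i) = k i.
    by apply/funext => s; rewrite mxE.
  by have [] := hk i T0.
have : (@lebesgue_measure R).-integrable setT (EFin \o kernel_bound k T).
  apply: cutoff_integrable => //.
  rewrite -integral_cutoff.
  have -> : (fun s => (cutoff T (fun s => norm1 (\row_i k i s) ^+ 2) s)%:E) =
      (fun s => (kernel_bound k T s ^+ 2)%:E).
    apply/funext => s; congr EFin; rewrite /kernel_bound /cutoff.
    by case: ifP => //; rewrite expr0n.
  exact: kernel_bound_sqr_integral.
move=> /integrableP[_]; apply: le_lt_trans.
rewrite le_eqVlt; apply/orP; left; apply/eqP; apply: eq_integral => s _.
by rewrite /= ger0_norm// kernel_bound_ge0.
Qed.

(** The weighted supremum norm appears only as a pointwise bound by [M * expR (n%:R * t)], so no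
    function space has to be constructed. *)
Lemma picard_contraction : exists n : nat, forall (x y : R -> 'rV[R]_d) (M : R),
  0 <= M -> coordwise_continuous x -> coordwise_continuous y ->
  (forall t, norm1 (x t - y t) <= M * expR (n%:R * t)) ->
  forall t, norm1 (picard G k T x t - picard G k T y t) <= M / 2 * expR (n%:R * t).
Proof.
have mk : measurable_fun [set: R] (kernel_bound k T) by exact: measurable_kernel_bound.
(* Multiplied by [L] this is at most [1/2]; [L + 1] covers the case [L = 0]. *)
have e0 : 0 < (2 * (L + 1))^-1 by rewrite invr_gt0 mulr_gt0// ltr_wpDl.
have [|n nsmall] := laplace_weight_small mk (kernel_bound_ge0 k T) _ kernel_bound_integral e0.
  by move=> s; exact: cutoff_lt0.
exists n => x y M M0 cx cy xy t.
pose h s := L * norm1 (x (t - s) - y (t - s)).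
have msub : measurable_fun [set: R] (fun s : R => t - s) by exact: measurable_funB.
have mxy : measurable_fun [set: R] (fun s => norm1 (x s - y s)).
  by apply: continuous_measurable_fun; apply: norm1_continuous; exact: coordwise_continuousB.
have mh : measurable_fun [set: R] h.
  by apply: measurable_funM => //; exact: measurableT_comp mxy msub.
have h0 s : 0 <= h s by rewrite mulr_ge0// norm1_ge0.
rewrite -lee_fin.
have -> : norm1 (picard G k T x t - picard G k T y t) =
    \sum_i `| \int[lebesgue_measure]_(s in `[0, t])
        (G (x (t - s)) ord0 i * cutoff T (k i) s) -
      \int[lebesgue_measure]_(s in `[0, t]) (G (y (t - s)) ord0 i * cutoff T (k i) s)|.
  by apply: eq_bigr => i _; rewrite !mxE.
apply: (@le_trans _ _ (\int[lebesgue_measure]_s (h s * kernel_bound k T s)%:E)%E).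
  apply: (@convolution_diff_le R d (fun i => cutoff T (k i))
    (fun i s => G (x (t - s)) ord0 i) (fun i s => G (y (t - s)) ord0 i)) => //.
  - by move=> i; exact: picard_integrable.
  - by move=> i; exact: picard_integrable.
  - exact: kernel_bound_ge0.
  move=> s _; have [sT|sT] := boolP (0 <= s <= T).
    by rewrite -kernel_boundE//; apply: ler_sum => i _; rewrite cutoff_id.
  by rewrite big1 ?kernel_bound_ge0// => i _; rewrite /cutoff (negbTE sT) normr0.
apply: (@le_trans _ _ (\int[lebesgue_measure]_s ((L * M * expR (n%:R * t))%:E *
    (expR (- (n%:R * s)) * kernel_bound k T s)%:E))%E).
  apply: ge0_le_integral => //.
  - by move=> s _; rewrite lee_fin mulr_ge0// kernel_bound_ge0.
  - by apply/measurable_EFinP; exact: measurable_funM.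
  - apply/measurable_EFinP; do 2 apply: measurable_funM => //.
    exact: measurable_laplace_weight.
  move=> s _; rewrite -EFinM lee_fin mulrA ler_wpM2r ?kernel_bound_ge0//.
  rewrite -[leRHS]mulrA -expRD /h -mulrA ler_wpM2l//.
  by rewrite -mulrBr; exact: xy.
rewrite ge0_integralZl_EFin//; last 3 first.
- by move=> s _; rewrite lee_fin mulr_ge0 ?expR_ge0 ?kernel_bound_ge0.
- apply/measurable_EFinP; apply: measurable_funM => //.
  exact: measurable_laplace_weight.
- by rewrite !mulr_ge0 ?expR_ge0.
apply: (@le_trans _ _ ((L * M * expR (n%:R * t))%:E * ((2 * (L + 1))^-1)%:E)%E).
  by rewrite lee_wpmul2l// lee_fin !mulr_ge0 ?expR_ge0.
rewrite -EFinM lee_fin mulrAC ler_wpM2r ?expR_ge0//.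
have -> : L * M / (2 * (L + 1)) = (M / 2) * (L / (L + 1)).
  by field; rewrite gt_eqF// ltr_wpDl.
by rewrite ler_piMr ?divr_ge0// ler_pdivrMr ?ltr_wpDl// mul1r lerDl.
Qed.
End Picard.

(** The explicit rate matters: applied at each time [t], with [a] increasing in [t], it gives
    locally uniform convergence of the Picard iterates. *)
Lemma geometric_cauchy (R : realType) (u : nat -> R) (a : R) :
  (forall m, `|u m.+1 - u m| <= a * 2^-1 ^+ m) ->
  exists l, forall m, `|l - u m| <= 2 * a * 2^-1 ^+ m.
Proof.
move=> ua.
(* Keeping the subtracted term [2^-1 ^+ (m + q)] makes the induction on [q] close. *)
have step m q : `|u (m + q)%N - u m| <= 2 * a * (2^-1 ^+ m - 2^-1 ^+ (m + q)).
  elim: q => [|q IH]; first by rewrite addn0 !subrr normr0 mulr0.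
  rewrite addnS; have := ua (m + q)%N; rewrite exprS => h.
  apply: le_trans (ler_distD (u (m + q)%N) _ _) _.
  apply: le_trans (lerD h IH) _; lra.
have a0 : 0 <= a by have := ua 0%N; rewrite expr0 mulr1; apply: le_trans.
have stepW m n : (m <= n)%N -> `|u n - u m| <= 2 * a * 2^-1 ^+ m.
  move=> mn; rewrite -(subnKC mn); apply: le_trans (step _ _) _.
  by rewrite ler_wpM2l ?mulr_ge0// gerBl exprn_ge0.
have ucv : cvgn u.
  have -> : u = cst (u 0%N) + series (telescope u).
    by apply/funext => n; rewrite {1}(eq_sum_telescope u n).
  apply: is_cvgD; first exact: is_cvg_cst.
  apply: normed_cvg; apply: (@series_le_cvg _ _ (geometric a 2^-1)).
  - by move=> n /=.
  - by move=> n; rewrite /geometric/= mulr_ge0// exprn_ge0.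
  - by move=> n; rewrite /telescope/=; exact: ua.
  - by apply: is_cvg_geometric_series; rewrite ger0_norm ?invr_ge0// invf_lt1// ltr1n.
exists (limn u) => m; apply/ler_addgt0Pl => e e0.
have /cvgrPdist_lt /(_ e e0) [N _ NP] := ucv.
have /NP /= h := leq_maxl N m.
apply: le_trans (ler_distD (u (maxn N m)) _ _) _.
by rewrite lerD ?(ltW h)// stepW// leq_maxr.
Qed.

Lemma geometric_le0 (R : realType) (r c : R) :
  (forall m, r <= c * 2^-1 ^+ m) -> r <= 0.
Proof.
move=> rc.
have cv : (fun m => c * 2^-1 ^+ m) @ \oo --> c * (0 : R).
  by apply: cvgMr; apply: cvg_expr; rewrite ger0_norm ?invr_ge0// invf_lt1// ltr1n.
rewrite mulr0 in cv; apply/ler_addgt0Pl => e e0; rewrite addr0.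
have [N _ /(_ N (leqnn N)) /= h] := @cvgr_lt _ _ _ _ _ _ cv e e0.
exact: le_trans (rc N) (ltW h).
Qed.

Lemma lipschitz_solution (R : realType) (d : nat) (G : 'rV[R]_d -> 'rV[R]_d)
    (k : 'I_d -> R -> R) (T L B : R) :
  0 < T -> (forall i, L2loc (k i)) -> 0 <= L ->
  (forall u v i, `|G u ord0 i - G v ord0 i| <= L * norm1 (u - v)) ->
  (forall u i, `|G u ord0 i| <= B) ->
  exists psi : R -> 'rV[R]_d, coordwise_continuous psi /\
    forall t, 0 <= t <= T -> volterra_at G k psi t.
Proof.
move=> T0 hk L0 GL GB.
pose Phi := picard G k T.
have [n contr] := picard_contraction T0 hk L0 GL GB.
pose X m := iter m Phi (fun=> 0).
have XS m : X m.+1 = Phi (X m) by [].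
have X0 m t : t <= 0 -> X m t = 0 by case: m => // m t0; rewrite XS; exact: picard_le0.
have cX m : coordwise_continuous (X m).
  elim: m => [|m IH]; first by move=> i; exact: cst_continuous.
  by rewrite XS; apply: (picard_continuous T0 hk GL GB IH) => t; exact: X0.
(* For [t > 0] the first increment is at most [|B|] times the integral of the kernel bound, and the
   exponential is at least [1]. For [t <= 0], where the exponential may be small, both iterates are
   [0]. *)
have [M M0 XM] : exists2 M, 0 <= M & forall t, norm1 (X 1%N t - X 0%N t) <= M * expR (n%:R * t).
  have mk : measurable_fun [set: R] (kernel_bound k T) by exact: measurable_kernel_bound.
  have B0 : 0 <= `|B| by [].
  pose I := (\int[lebesgue_measure]_s (`|B| * kernel_bound k T s)%:E)%E.
  have I0 : (0 <= I)%E.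
    by apply: integral_ge0 => s _; rewrite lee_fin mulr_ge0// kernel_bound_ge0.
  have Ifin : I \is a fin_num.
    rewrite ge0_fin_numE// /I; under eq_integral do rewrite EFinM.
    rewrite ge0_integralZl_EFin//; last 2 first.
    - by move=> s _; rewrite lee_fin kernel_bound_ge0.
    - exact/measurable_EFinP.
    by rewrite lte_mul_pinfty// kernel_bound_integral.
  exists (fine I) => [|t]; first exact: fine_ge0.
  have [t0|t0] := leP t 0.
    by rewrite !X0// subrr norm1_0 mulr_ge0 ?expR_ge0 ?fine_ge0.
  apply: (@le_trans _ _ (fine I)); last first.
    by rewrite ler_peMr ?fine_ge0// -expR0 ler_expR mulr_ge0// ltW.
  rewrite -lee_fin fineK// subr0.
  have -> : norm1 (X 1%N t) = \sum_i `| \int[lebesgue_measure]_(s in `[0, t])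
        (G (X 0%N (t - s)) ord0 i * cutoff T (k i) s) -
      \int[lebesgue_measure]_(s in `[0, t]) (0 * cutoff T (k i) s)|.
    apply: eq_bigr => i _; rewrite !mxE.
    have -> : \int[lebesgue_measure]_(s in `[0, t]) (0 * cutoff T (k i) s) = 0.
      by rewrite /Rintegral (eq_integral (cst 0%E)) ?integral0// => s _; rewrite mul0r.
    by rewrite subr0.
  apply: (@convolution_diff_le R d (fun i => cutoff T (k i))
    (fun i s => G (X 0%N (t - s)) ord0 i) (fun _ _ => 0) (fun=> `|B|)) => //.
  - by move=> i; exact: (picard_integrable T0 hk GL GB t i (cX 0%N)).
  - move=> i; apply: (@eq_integrable _ _ _ _ _ _ (cst 0%E)); last exact: integrable0.
      exact: measurable_itv.
    by move=> s _; rewrite /= mul0r.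
  - exact: kernel_bound_ge0.
  - by move=> i s _; rewrite subr0 (le_trans (GB _ _))// ler_norm.
  move=> s _; have [sT|sT] := boolP (0 <= s <= T).
    by rewrite -kernel_boundE//; apply: ler_sum => i _; rewrite cutoff_id.
  by rewrite big1 ?kernel_bound_ge0// => i _; rewrite /cutoff (negbTE sT) normr0.
have XX m t : norm1 (X m.+1 t - X m t) <= M * 2^-1 ^+ m * expR (n%:R * t).
  elim: m t => [|m IH] t; first by rewrite expr0 mulr1.
  rewrite [2^-1 ^+ _]exprSr mulrA.
  apply: (contr (X m.+1) (X m) _ _ (cX _) (cX _) IH).
  by rewrite mulr_ge0// exprn_ge0.
have lim_ex t i : exists l, forall m,
    `|l - X m t ord0 i| <= 2 * (M * expR (n%:R * t)) * 2^-1 ^+ m.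
  apply: geometric_cauchy => m; rewrite mulrAC.
  apply: le_trans (XX m t); have := norm1_coord (X m.+1 t - X m t) i.
  by rewrite !mxE.
pose psi t := \row_i sval (cid (lim_ex t i)) : 'rV[R]_d.
have psiX t i m : `|psi t ord0 i - X m t ord0 i| <= 2 * (M * expR (n%:R * t)) * 2^-1 ^+ m.
  by rewrite mxE; case: cid => l lP /=.
have cpsi : coordwise_continuous psi.
  move=> i t0; apply/cvgrPdist_lt => e e0.
  (* The error bound increases with [t], so its value at [t0 + 1] controls the error on a whole
     neighbourhood of [t0]. *)
  pose c := 2 * (M * expR (n%:R * (t0 + 1))).
  have [m cm] : exists m, c * 2^-1 ^+ m < e / 3.
    apply: contrapT => /forallNP H.
    have : e / 3 <= 0.
      by apply: (@geometric_le0 _ _ c) => m; rewrite leNgt; apply/negP/H.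
    by apply/negP; rewrite -ltNge divr_gt0.
  have Xc : \forall t \near t0, `|X m t0 ord0 i - X m t ord0 i| < e / 3.
    by have /cvgrPdist_lt := cX m i t0; apply; rewrite divr_gt0.
  have tlt : \forall t \near t0, t < t0 + 1 by apply: lt_nbhsl; rewrite ltrDl.
  have bnd t : t < t0 + 1 -> `|psi t ord0 i - X m t ord0 i| < e / 3.
    move=> tt; apply: le_lt_trans cm; apply: le_trans (psiX t i m) _.
    rewrite ler_wpM2r ?exprn_ge0// /c ler_wpM2l// ler_wpM2l// ler_expR.
    by rewrite ler_wpM2l// ltW.
  near=> t.
  have b0 : `|psi t0 ord0 i - X m t0 ord0 i| < e / 3 by apply: bnd; rewrite ltrDl.
  have b1 : `|psi t ord0 i - X m t ord0 i| < e / 3 by apply: bnd; near: t.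
  have b2 : `|X m t0 ord0 i - X m t ord0 i| < e / 3 by near: t.
  have -> : psi t0 ord0 i - psi t ord0 i = (psi t0 ord0 i - X m t0 ord0 i) +
    (X m t0 ord0 i - X m t ord0 i) - (psi t ord0 i - X m t ord0 i) by ring.
  apply: le_lt_trans (ler_normB _ _) _.
  apply: le_lt_trans (lerD (ler_normD _ _) (lexx _)) _; lra.
have psiX1 m t : norm1 (psi t - X m t) <= d%:R * 2 * M * 2^-1 ^+ m * expR (n%:R * t).
  rewrite /norm1; apply: (@le_trans _ _ (\sum_(i < d) 2 * (M * expR (n%:R * t)) * 2^-1 ^+ m)).
    by apply: ler_sum => i _; have := psiX t i m; rewrite !mxE.
  rewrite sumr_const card_ord -mulr_natl le_eqVlt; apply/orP; left; apply/eqP; ring.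
(* By [psiX1] the pair [psi], [X m] satisfies the hypothesis of the contraction, so [Phi (X m)]
   tends to [Phi psi] at a geometric rate. *)
have fix_psi t : psi t = Phi psi t.
  apply/eqP; rewrite -subr_eq0; apply/eqP/norm1_eq0/eqP; rewrite eq_le norm1_ge0 andbT.
  apply: (@geometric_le0 _ _ (d%:R * 2 * M * expR (n%:R * t))) => m.
  have h1 := psiX1 m.+1 t.
  have h2 : norm1 (Phi psi t - Phi (X m) t) <=
      (d%:R * 2 * M * 2^-1 ^+ m) / 2 * expR (n%:R * t).
    by apply: contr => //; rewrite !mulr_ge0// exprn_ge0.
  have -> : psi t - Phi psi t = (psi t - X m.+1 t) - (Phi psi t - Phi (X m) t).
    by rewrite XS opprB addrA subrK.
  apply: le_trans (norm1D _ _) _; rewrite norm1N.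
  apply: le_trans (lerD h1 h2) _.
  rewrite exprS le_eqVlt; apply/orP; left; apply/eqP; by field.
exists psi; split=> // t /andP[t0 tT] i.
have mI : measurable (`[0, t] : set (measurableTypeR R)) by exact: measurable_itv.
have E s : `[0, t]%classic s -> cutoff T (k i) s = k i s.
  rewrite /= in_itv/= => /andP[s0 st]; rewrite cutoff_id// s0/=; exact: le_trans st tT.
split.
  have := picard_integrable T0 hk GL GB t i cpsi; apply: eq_integrable => // s.
  by rewrite inE => sI; rewrite /= E.
rewrite {1}fix_psi mxE; apply: eq_Rintegral => s; rewrite inE => sI.
by rewrite E.
Unshelve. all: by end_near.
Qed.

(** * Truncation and continuation *)

(** Causality: the equation at [t] sees only the values on [[0, t]]. This serves both to remove a
    truncation and to replace one solution by another. *)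
Lemma volterra_at_eq (R : realType) (d : nat) (F G : 'rV[R]_d -> 'rV[R]_d)
    (k : 'I_d -> R -> R) (phi psi : R -> 'rV[R]_d) (t : R) : 0 <= t ->
  phi t = psi t -> (forall s, 0 <= s <= t -> F (phi s) = G (psi s)) ->
  volterra_at F k phi t -> volterra_at G k psi t.
Proof.
move=> t0 phit FG sol i; have [fint fE] := sol i.
have mI : measurable (`[0, t] : set (measurableTypeR R)) by exact: measurable_itv.
have E s : s \in `[0, t]%classic -> F (phi (t - s)) = G (psi (t - s)).
  rewrite inE/= in_itv/= => /andP[s0 st]; apply: FG.
  by rewrite subr_ge0 st gerBl.
split; first by apply: eq_integrable fint => // s sI /=; rewrite E.
by rewrite -phit fE; apply: eq_Rintegral => s sI; rewrite E.
Qed.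

Lemma volterra_at0 (R : realType) (d : nat) (G : 'rV[R]_d -> 'rV[R]_d)
    (k : 'I_d -> R -> R) (psi : R -> 'rV[R]_d) :
  volterra_at G k psi 0 -> psi 0 = 0.
Proof.
move=> sol; apply/rowP => i; rewrite mxE (sol i).2.
by rewrite set_itv1 Rintegral_set1.
Qed.

Lemma coordwise_continuous_vec_L2 (R : realType) (d : nat) (x : R -> 'rV[R]_d) (T : R) :
  coordwise_continuous x -> vec_L2 `[0, T] x.
Proof.
move=> cx; have mx := coordwise_continuous_measurable (measurable_itv `[0, T]) cx.
split=> //; apply/vec_L2P => //.
have cn : continuous (fun t => norm1 (x t) ^+ 2).
  move=> t; have -> : (fun t => norm1 (x t) ^+ 2) = (fun t => norm1 (x t) * norm1 (x t)).
    by apply/funext => s; rewrite expr2.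
  by apply: cvgM; exact: norm1_continuous.
have /integrableP[_] := @continuous_compact_integrable R (fun t => norm1 (x t) ^+ 2)
  `[0, T] (@segment_compact R 0 T) (continuous_subspaceT cn).
apply: le_lt_trans; rewrite le_eqVlt; apply/orP; left; apply/eqP.
by apply: eq_integral => s _; rewrite /= ger0_norm// sqr_ge0.
Qed.

Lemma coordwise_continuous_unique (R : realType) (d : nat) (G : 'rV[R]_d -> 'rV[R]_d)
    (k : 'I_d -> R -> R) (C T : R) (phi psi : R -> 'rV[R]_d) :
  0 <= T -> 0 <= C -> quad_lipschitz C G -> (forall i, L2loc (k i)) ->
  coordwise_continuous phi -> coordwise_continuous psi ->
  (forall t, 0 <= t <= T -> volterra_at G k phi t) ->
  (forall t, 0 <= t <= T -> volterra_at G k psi t) ->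
  forall t, 0 <= t <= T -> phi t = psi t.
Proof.
rewrite le_eqVlt => /predU1P[<-|T0] C0 GC hk cphi cpsi sphi spsi t tT.
  have -> : t = 0 by apply/eqP; rewrite eq_le andbC.
  by rewrite !(volterra_at0 (G := G) (k := k))//; [apply: spsi|apply: sphi]; rewrite lexx.
apply: (volterra_unique T0 C0 GC hk) (sphi _ tT) (spsi _ tT) => //.
- exact: coordwise_continuous_vec_L2.
- exact: coordwise_continuous_vec_L2.
- by apply: aeW => s sT; split; [exact: sphi|exact: spsi].
Qed.

(** Entrywise projection onto a cube; unlike a radial truncation it is visibly non-expansive for
    [norm1]. *)
Definition clamp (R : realType) (d : nat) (n : R) (u : 'rV[R]_d) : 'rV[R]_d :=
  \row_i Num.max (- n) (Num.min n (u ord0 i)).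

Lemma clamp_id (R : realType) (d : nat) (n : R) (u : 'rV[R]_d) :
  norm1 u <= n -> clamp n u = u.
Proof.
move=> un; apply/rowP => i; rewrite mxE.
have /ler_normlP[h1 h2] := le_trans (norm1_coord u i) un.
by rewrite min_r// max_r// lerNl.
Qed.

Lemma clamp_cases (R : realType) (n x : R) : 0 <= n ->
  let c := Num.max (- n) (Num.min n x) in
  [\/ c = x /\ -n <= x <= n, c = n /\ n <= x | c = - n /\ x <= - n].
Proof.
move=> n0 /=; have [nx|xn] := leP n x.
  by apply: Or32; split=> //; rewrite max_r//; lra.
have [h|h] := leP (- n) x; first by apply: Or31; rewrite ltW.
by apply: Or33; split=> //; exact: ltW.
Qed.

Lemma norm1_clampB (R : realType) (d : nat) (n : R) (u v : 'rV[R]_d) :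
  0 <= n -> norm1 (clamp n u - clamp n v) <= norm1 (u - v).
Proof.
move=> n0; apply: ler_sum => i _; rewrite !mxE.
set a := u ord0 i; set b := v ord0 i.
have h1 := ler_norm (a - b); have h2 := ler_norm (b - a).
rewrite distrC in h2; have h3 := normr_ge0 (a - b).
rewrite ler_norml.
by case: (clamp_cases a n0) => -[-> h4]; case: (clamp_cases b n0) => -[-> h5];
  apply/andP; split; lra.
Qed.

Lemma norm1_clamp (R : realType) (d : nat) (n : R) (u : 'rV[R]_d) :
  0 <= n -> norm1 (clamp n u) <= norm1 u.
Proof.
move=> n0; have := norm1_clampB u 0 n0.
by rewrite (@clamp_id _ _ n 0) ?norm1_0// !subr0.
Qed.

Lemma norm1_clamp_le (R : realType) (d : nat) (n : R) (u : 'rV[R]_d) :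
  0 <= n -> norm1 (clamp n u) <= d%:R * n.
Proof.
move=> n0; rewrite /norm1 mulr_natl -[X in _ *+ X](card_ord d) -sumr_const.
apply: ler_sum => i _; rewrite mxE ler_norml.
by case: (clamp_cases (u ord0 i) n0) => -[-> h]; apply/andP; split; lra.
Qed.

Section Clamped.
Context (R : realType) (d : nat) (F : 'rV[R]_d -> 'rV[R]_d) (C n : R).
Hypothesis (C0 : 0 <= C) (FC : quad_lipschitz C F) (n0 : 0 <= n).

(** [clamp] increases neither distances nor norms, so [C] is kept and the uniqueness result covers
    the truncated equation too. *)
Lemma clamped_quad_lipschitz : quad_lipschitz C (F \o clamp n).
Proof.
move=> u v i; apply: le_trans (FC _ _ _) _; rewrite ler_wpM2l//.
apply: ler_pM; rewrite ?norm1_ge0 ?addr_ge0 ?norm1_ge0//.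
  exact: norm1_clampB.
by rewrite !lerD// norm1_clamp.
Qed.

Lemma clamped_lipschitz u v i :
  `|(F \o clamp n) u ord0 i - (F \o clamp n) v ord0 i| <=
  C * (1 + d%:R * n + d%:R * n) * norm1 (u - v).
Proof.
apply: le_trans (FC _ _ _) _; rewrite -mulrA ler_wpM2l// mulrC.
apply: ler_pM; rewrite ?norm1_ge0 ?addr_ge0 ?norm1_ge0//.
  by rewrite !lerD// norm1_clamp_le.
exact: norm1_clampB.
Qed.

Lemma clamped_bounded u i :
  `|(F \o clamp n) u ord0 i| <= norm1 (F 0) + C * (d%:R * n * (1 + d%:R * n)).
Proof.
rewrite -[X in `|X|](subrK (F 0 ord0 i)) addrC (le_trans (ler_normD _ _))//.
rewrite lerD ?norm1_coord//; apply: le_trans (FC _ _ _) _.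
rewrite subr0 norm1_0 addr0 ler_wpM2l//.
apply: ler_pM; rewrite ?addr_ge0 ?norm1_ge0 ?lerD2l ?norm1_clamp_le//.
Qed.
End Clamped.

Definition continuous_solution_upto (R : realType) (d : nat)
    (F : 'rV[R]_d -> 'rV[R]_d) (k : 'I_d -> R -> R) (T : R) (psi : R -> 'rV[R]_d) :=
  coordwise_continuous psi /\ forall t, 0 <= t <= T -> volterra_at F k psi t.

(** [chi] is only asked to agree with a continuous solution on each [[0, t]], [t < T], since a limit
    at [T] is not yet known to exist. For [T = 0] these hypotheses are vacuous and the result is
    local existence. *)
Lemma bounded_solution_extends (R : realType) (d : nat) (F : 'rV[R]_d -> 'rV[R]_d)
    (k : 'I_d -> R -> R) (C T M : R) (chi : R -> 'rV[R]_d) :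
  0 <= C -> quad_lipschitz C F -> (forall i, L2loc (k i)) -> 0 <= T -> 0 <= M ->
  (forall t, 0 <= t < T -> exists2 psi, continuous_solution_upto F k t psi &
    forall s, 0 <= s <= t -> psi s = chi s) ->
  (forall t, 0 <= t < T -> norm1 (chi t) <= M) ->
  exists T' phi, T < T' /\ continuous_solution_upto F k T' phi.
Proof.
move=> C0 FC hk T0 M0 chi_sol chiM.
(* The margin [1] lets the solution grow past [M] after time [T] before the truncation acts. *)
pose n := M + 1; have n0 : 0 <= n by rewrite addr_ge0.
pose G := F \o clamp n.
have GF u : norm1 u <= n -> G u = F u by move=> un; rewrite /G/= clamp_id.
have GC : quad_lipschitz C G by exact: clamped_quad_lipschitz.
have T1 : 0 < T + 1 by rewrite ltr_wpDl.
have L0 : 0 <= C * (1 + d%:R * n + d%:R * n) by rewrite !(mulr_ge0, addr_ge0).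
have [phi [cphi sphi]] := lipschitz_solution T1 hk L0
  (clamped_lipschitz C0 FC n0) (clamped_bounded C0 FC n0).
have phiE t : 0 <= t < T -> phi t = chi t.
  move=> /andP[t0 tT]; have [|psi [cpsi spsi] psiE] := chi_sol t; first by rewrite t0.
  rewrite -psiE ?t0 ?lexx//.
  apply: (coordwise_continuous_unique t0 C0 GC hk cphi cpsi) => [s /andP[s0 st]|s /andP[s0 st]|].
  - by apply: sphi; rewrite s0/=; lra.
  - apply: (volterra_at_eq s0 (F := F) (phi := psi)) => // [r /andP[r0 rs]|].
      rewrite GF// psiE ?r0 ?(le_trans rs)// (le_trans (chiM _ _)) ?lerDl//.
      by rewrite r0/=; lra.
    by apply: spsi; rewrite s0.
  - by rewrite t0/=.
have cn := norm1_continuous cphi.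
have phiT : norm1 (phi T) <= M.
  rewrite leNgt; apply/negP => MT.
  have [T00|Tn0] := eqVneq T 0.
    move: MT; rewrite T00 (volterra_at0 (G := G) (k := k)) ?norm1_0 ?ltNge ?M0//.
    by apply: sphi; rewrite lexx ltW.
  have Tpos : 0 < T by rewrite lt_neqAle eq_sym Tn0.
  have /nbhs_ballP[e /= e0 eP] : \forall t \near T, M < norm1 (phi t).
    exact: (cvgr_gt _ (cn T)).
  (* A time before [T], close enough for the strict inequality to persist and still nonnegative. *)
  pose t := T - Num.min (e / 2) T.
  have tT : 0 <= t < T.
    by rewrite /t /Num.min; case: ltP => h; apply/andP; split; lra.
  have : M < norm1 (phi t).
    apply: eP; rewrite /ball/= /t opprB addrC subrK ger0_norm.
      by rewrite gt_min; apply/orP; left; lra.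
    by rewrite le_min; apply/andP; split; lra.
  by rewrite phiE// ltNge chiM.
have /nbhs_ballP[e /= e0 eP] : \forall t \near T, norm1 (phi t) < n.
  by apply: (cvgr_lt _ (cn T)); rewrite (le_lt_trans phiT)// ltrDl.
(* The minimum with [1] is there because [phi] solves the truncated equation on [[0, T + 1]]
   only. *)
pose T' := T + Num.min (e / 2) 1.
have TT' : T < T' by rewrite ltrDl lt_min ltr01 andbT divr_gt0.
have phin t : 0 <= t <= T' -> norm1 (phi t) <= n.
  move=> /andP[t0 tT']; have [tT|Tt] := ltP t T.
    by rewrite phiE ?t0// (le_trans (chiM _ _)) ?t0 ?lerDl.
  apply/ltW/eP; rewrite /ball/= distrC ger0_norm ?subr_ge0//.
  have : t - T <= e / 2.
    by rewrite lerBlDl (le_trans tT')// lerD2l ge_min lexx.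
  lra.
exists T', phi; split=> //; split=> // t /andP[t0 tT'].
apply: (volterra_at_eq t0 (F := G) (phi := phi)) => // [s /andP[s0 st]|].
  by rewrite GF// phin// s0 (le_trans st).
apply: sphi; rewrite t0 (le_trans tT')// lerD2l ge_min lexx orbT//.
Qed.

(** In the quadratic term one factor is estimated by the weighted maximum [m], the other stays as
    [Y]. The square integral of [Y] is taken over all of [[0, T]], so the bound does not depend on
    [t < T]. *)
Lemma square_integrable_solution_bounded (R : realType) (d : nat)
    (F : 'rV[R]_d -> 'rV[R]_d) (k : 'I_d -> R -> R) (C T : R) (chi : R -> 'rV[R]_d) :
  0 <= C -> quad_lipschitz C F -> (forall i, L2loc (k i)) -> 0 < T ->
  vec_L2 `[0, T] chi ->
  (forall t, 0 <= t < T -> exists2 psi, continuous_solution_upto F k t psi &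
    forall s, 0 <= s <= t -> psi s = chi s) ->
  exists2 M, 0 <= M & forall t, 0 <= t < T -> norm1 (chi t) <= M.
Proof.
move=> C0 FC hk T0 [mchi chi2] chi_sol.
have mI : measurable (`[0, T] : set (measurableTypeR R)) by exact: measurable_itv.
pose Y := cutoff T (fun t => norm1 (chi t)).
pose kappa := kernel_bound k T.
have mY : measurable_fun [set: R] Y by apply: measurable_cutoff; exact: measurable_norm1.
have mk : measurable_fun [set: R] kappa by exact: measurable_kernel_bound.
have Y0 t : 0 <= Y t by apply: cutoff_ge0 => s; exact: norm1_ge0.
have k0 t : 0 <= kappa t by exact: kernel_bound_ge0.
have Yint : (\int[lebesgue_measure]_t (Y t ^+ 2)%:E < +oo)%E.
  have -> : (fun t => (Y t ^+ 2)%:E) = (fun t => (cutoff T (fun t => norm1 (chi t) ^+ 2) t)%:E).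
    by apply/funext => t; rewrite /Y /cutoff; case: ifP => //; rewrite expr0n.
  by rewrite integral_cutoff; exact/vec_L2P.
pose J := fine (\int[lebesgue_measure]_t (Y t ^+ 2)%:E)%E.
have JE : (\int[lebesgue_measure]_t (Y t ^+ 2)%:E = J%:E)%E.
  by rewrite fineK// ge0_fin_numE//; apply: integral_ge0 => t _; rewrite lee_fin sqr_ge0.
have J0 : 0 <= J by apply/fine_ge0/integral_ge0 => t _; rewrite lee_fin sqr_ge0.
pose I := fine (\int[lebesgue_measure]_s (kappa s)%:E)%E.
have IE : (\int[lebesgue_measure]_s (kappa s)%:E = I%:E)%E.
  rewrite fineK// ge0_fin_numE; first exact: kernel_bound_integral.
  by apply: integral_ge0 => t _; rewrite lee_fin.
have I0 : 0 <= I by apply/fine_ge0/integral_ge0 => t _; rewrite lee_fin.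
have C20 : 0 <= 2 * C by exact: mulr_ge0.
have kneg s : s < 0 -> kappa s = 0 by exact: cutoff_lt0.
have [n small] := weighted_kernel_small C20 J0 mk k0 kneg
  (kernel_bound_sqr_integral T0 hk).
(* From [quad_lipschitz] with [v = 0] and [x * (1 + x) <= 1 + 2 * x ^+ 2]. *)
pose B := norm1 (F 0) + C.
have B0 : 0 <= B by rewrite addr_ge0 ?norm1_ge0.
have FB u i : `|F u ord0 i| <= B + 2 * C * norm1 u ^+ 2.
  have h := FC u 0 i; rewrite subr0 norm1_0 addr0 in h.
  have h0 := norm1_coord (F 0) i.
  have -> : F u ord0 i = (F u ord0 i - F 0 ord0 i) + F 0 ord0 i by ring.
  apply: le_trans (ler_normD _ _) _; rewrite /B.
  have h2 : norm1 u * (1 + norm1 u) <= 1 + 2 * norm1 u ^+ 2.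
    by have := sqr_ge0 (norm1 u - 1); rewrite !expr2; nra.
  have := ler_wpM2l C0 h2; lra.
(* The estimate below gives [m <= B * I + m / 2], hence [m <= 2 * (B * I)]; the exponential undoes
   the weight. *)
exists (2 * (B * I) * expR (n%:R * T)) => [|t /andP[t0 tT]].
  by rewrite !mulr_ge0 ?expR_ge0 ?norm1_ge0.
have [|psi [cpsi spsi] psiE] := chi_sol t; first by rewrite t0.
rewrite -psiE ?t0 ?lexx//.
pose e r := expR (- (n%:R * r)) * norm1 (psi r).
have ce : {within `[0, t], continuous e}.
  apply: continuous_subspaceT => r; apply: cvgM; last exact: norm1_continuous.
  apply: (@continuous_comp R R R (fun r => - (n%:R * r)) expR); last exact: continuous_expR.
  by apply: cvgN; apply: cvgMr; exact: cvg_id.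
(* On the closed interval [[0, t]] the weighted maximum is attained, hence finite, so that [m / 2]
   can be absorbed. *)
have [r rt rmax] := EVT_max t0 ce.
move: rt; rewrite in_itv/= => /andP[r0 rt].
pose m := e r.
have m0 : 0 <= m by rewrite mulr_ge0 ?expR_ge0 ?norm1_ge0.
have psim s : 0 <= s <= t -> norm1 (psi s) <= m * expR (n%:R * s).
  move=> st; have : e s <= m by apply: rmax; rewrite in_itv.
  rewrite -(ler_pM2r (expR_gt0 (n%:R * s))) /e mulrAC -expRD addrC subrr expR0 mul1r.
  by [].
pose h s := B + 2 * C * (m * expR (n%:R * r)) * (Y (r - s) * expR (- (n%:R * s))).
have msub : measurable_fun [set: R] (fun s : R => r - s) by exact: measurable_funB.
have mYr : measurable_fun [set: R] (fun s => Y (r - s)) by exact: measurableT_comp mY msub.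
have mw := @measurable_laplace_weight R n%:R.
have mh : measurable_fun [set: R] h.
  by apply: measurable_funD => //; apply: measurable_funM => //; exact: measurable_funM.
have h0 s : 0 <= h s by rewrite addr_ge0// !mulr_ge0 ?expR_ge0 ?norm1_ge0.
have est : ((norm1 (psi r))%:E <= \int[lebesgue_measure]_s (h s * kappa s)%:E)%E.
  have -> : norm1 (psi r) = \sum_i `| \int[lebesgue_measure]_(s in `[0, r])
        (F (psi (r - s)) ord0 i * k i s) -
      \int[lebesgue_measure]_(s in `[0, r]) (0 * k i s)|.
    apply: eq_bigr => i _.
    have -> : \int[lebesgue_measure]_(s in `[0, r]) (0 * k i s) = 0.
      by rewrite /Rintegral (eq_integral (cst 0%E)) ?integral0// => s _; rewrite mul0r.
    by rewrite subr0 -(spsi r _ i).2// r0.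
  apply: (@convolution_diff_le R d k (fun i s => F (psi (r - s)) ord0 i) (fun _ _ => 0)) => //.
  - by move=> i; apply: (spsi r _ i).1; rewrite r0.
  - move=> i; apply: (@eq_integrable _ _ _ _ _ _ (cst 0%E)); last exact: integrable0.
      exact: measurable_itv.
    by move=> s _; rewrite /= mul0r.
  - move=> i s /andP[s0 sr]; rewrite subr0 (le_trans (FB _ _))// /h lerD2l.
    have -> : 2 * C * (m * expR (n%:R * r)) * (Y (r - s) * expR (- (n%:R * s))) =
        2 * C * ((m * expR (n%:R * (r - s))) * Y (r - s)).
      by rewrite mulrBr expRD; ring.
    rewrite ler_wpM2l// expr2.
    have rs : 0 <= r - s <= t by apply/andP; split; lra.
    have -> : Y (r - s) = norm1 (psi (r - s)).
      by rewrite /Y cutoff_id ?psiE//; apply/andP; split; lra.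
    by rewrite ler_wpM2r ?norm1_ge0// psim.
  - move=> s /andP[s0 sr]; rewrite (@kernel_boundE _ _ _ T)//.
    by rewrite s0/=; lra.
have main : norm1 (psi r) <= B * I + m * expR (n%:R * r) / 2.
  rewrite -lee_fin; apply: le_trans est _.
  have -> : (\int[lebesgue_measure]_s (h s * kappa s)%:E =
      B%:E * \int[lebesgue_measure]_s (kappa s)%:E + (m * expR (n%:R * r))%:E *
      ((2 * C)%:E * \int[lebesgue_measure]_s
         (Y (r - s)%R * (expR (- (n%:R * s)%R) * kappa s))%:E))%E.
    have mV : measurable_fun [set: R] (fun s => Y (r - s) * (expR (- (n%:R * s)) * kappa s)).
      by apply: measurable_funM => //; exact: measurable_funM.
    have V0 s : 0 <= Y (r - s) * (expR (- (n%:R * s)) * kappa s).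
      by rewrite !mulr_ge0 ?expR_ge0 ?norm1_ge0.
    have me0 : 0 <= m * expR (n%:R * r) by rewrite mulr_ge0 ?expR_ge0 ?norm1_ge0.
    rewrite -ge0_integralZl_EFin//; last 2 first.
    - by move=> s _; rewrite lee_fin.
    - exact/measurable_EFinP.
    rewrite -ge0_integralZl_EFin//; last 2 first.
    - by move=> s _; rewrite lee_fin.
    - exact/measurable_EFinP.
    rewrite -ge0_integralZl_EFin//; last 2 first.
    - by move=> s _; rewrite -EFinM lee_fin mulr_ge0.
    - by apply/measurable_EFinP; exact: measurable_funM.
    rewrite -ge0_integralD//; last 4 first.
    - by move=> s _; rewrite -EFinM lee_fin mulr_ge0.
    - by apply/measurable_EFinP; exact: measurable_funM.
    - by move=> s _; rewrite -!EFinM lee_fin; do 2 rewrite mulr_ge0//.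
    - by apply/measurable_EFinP; do 2 apply: measurable_funM => //.
    apply: eq_integral => s _; rewrite -!EFinM -EFinD; congr EFin.
    by rewrite /h; ring.
  rewrite IE [leRHS]EFinD -EFinM leeD2l// [leRHS]EFinM lee_wpmul2l//.
    by rewrite lee_fin mulr_ge0 ?expR_ge0 ?norm1_ge0.
  apply: small => //.
  rewrite (@ge0_integral_reflect _ r (fun s => (Y s ^+ 2)%:E)) ?JE//.
    by apply/measurable_EFinP; exact: measurable_funX.
  by move=> s; rewrite lee_fin sqr_ge0.
have er0 := expR_gt0 (n%:R * r).
have mB : m <= 2 * (B * I).
  have er : 0 < expR (- (n%:R * r)) <= 1.
    by rewrite expR_gt0 -expR0 ler_expR oppr_le0 mulr_ge0.
  have : m <= expR (- (n%:R * r)) * (B * I) + m / 2.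
    rewrite {1}/m /e; apply: le_trans (ler_wpM2l (ltW (expR_gt0 _)) main) _.
    rewrite mulrDr lerD2l.
    have -> : expR (- (n%:R * r)) * (m * expR (n%:R * r) / 2) =
      (expR (- (n%:R * r)) * expR (n%:R * r)) * (m / 2) by ring.
    by rewrite -expRD addrC subrr expR0 mul1r.
  have : expR (- (n%:R * r)) * (B * I) <= B * I.
    by case/andP: er => _ er; rewrite ler_piMl// mulr_ge0.
  lra.
apply: le_trans (psim t _) _; first by rewrite t0/=.
apply: (ler_pM m0 (expR_ge0 _) mB).
by rewrite ler_expR ler_wpM2l// ltW.
Qed.

(** * The maximal solution *)

Lemma coordwise_continuous_mx (R : realType) (d : nat) (x : R -> 'rV[R]_d) :
  coordwise_continuous x -> continuous x.
Proof.
move=> cx t A [P PN PA].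
have H : \forall s \near t, forall j, P ord0 j (x s ord0 j).
  apply: (@filter_forall R _ (fun j s => P ord0 j (x s ord0 j)) _ (nbhs_filter t)) => j.
  exact: (cx j t (P ord0 j) (PN ord0 j)).
by apply: filterS H => s Ps; apply: PA => i j; rewrite (ord1 i).
Qed.

Lemma continuous_solution_upto_sub (R : realType) (d : nat)
    (F : 'rV[R]_d -> 'rV[R]_d) (k : 'I_d -> R -> R) (S T : R) (psi : R -> 'rV[R]_d) :
  S <= T -> continuous_solution_upto F k T psi -> continuous_solution_upto F k S psi.
Proof.
move=> ST [cpsi spsi]; split=> // t /andP[t0 tS].
by apply: spsi; rewrite t0 (le_trans tS).
Qed.

Lemma vec_L2_sub (R : realType) (d : nat) (S T : R) (x : R -> 'rV[R]_d) :
  S <= T -> vec_L2 `[0, T] x -> vec_L2 `[0, S] x.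
Proof.
move=> ST [mx x2].
have mT : measurable (`[0, T] : set (measurableTypeR R)) by exact: measurable_itv.
have mS : measurable (`[0, S] : set (measurableTypeR R)) by exact: measurable_itv.
have STs : `[0, S] `<=` `[0, T].
  by move=> t /=; rewrite !in_itv/= => /andP[-> tS]; exact: le_trans tS ST.
have mxS i : measurable_fun `[0, S] (fun t => x t ord0 i) by exact: measurable_funS (mx i).
split=> //; apply/vec_L2P => //; move/vec_L2P : x2 => /(_ mT mx).
apply: le_lt_trans; apply: ge0_subset_integral => //.
- apply/measurable_EFinP; apply: measurable_funX; exact: measurable_norm1.
- by move=> t _; rewrite lee_fin sqr_ge0.
Qed.

Lemma eq_vec_L2 (R : realType) (d : nat) (A : set R) (x y : R -> 'rV[R]_d) :
  {in A, x =1 y} -> vec_L2 A x -> vec_L2 A y.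
Proof.
move=> xy [mx x2]; split=> [i|].
  by apply: eq_measurable_fun (mx i) => t tA; rewrite xy.
apply/L2norm_lty; move/L2norm_lty : x2; congr (_ < _)%E.
by apply: eq_integral => t tA; rewrite xy.
Qed.

Section MaximalSolution.
Context (R : realType) (d : nat) (F : 'rV[R]_d -> 'rV[R]_d) (k : 'I_d -> R -> R) (C : R).
Hypothesis (C0 : 0 <= C) (FC : quad_lipschitz C F) (hk : forall i, L2loc (k i)).

Definition solvable_upto (T : R) : Prop := exists psi, continuous_solution_upto F k T psi.

Definition maximal_solution (t : R) : 'rV[R]_d :=
  if pselect (solvable_upto t) is left h then sval (cid h) t else 0.

Definition maximal_time : \bar R :=
  ereal_sup (EFin @` [set t | 0 <= t /\ solvable_upto t]).

Lemma maximal_solutionE (T : R) (psi : R -> 'rV[R]_d) :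
  continuous_solution_upto F k T psi ->
  forall t, 0 <= t <= T -> psi t = maximal_solution t.
Proof.
move=> sol t /andP[t0 tT].
have solt := continuous_solution_upto_sub tT sol.
rewrite /maximal_solution; case: pselect => [h|[]]; last by exists psi.
case: cid => phi [cphi sphi] /=; have [cpsi spsi] := solt.
by apply: (coordwise_continuous_unique t0 C0 FC hk cpsi cphi spsi sphi); rewrite t0/=.
Qed.

Lemma maximal_solution_pieces (T : R) : (forall t, 0 <= t < T -> solvable_upto t) ->
  forall t, 0 <= t < T -> exists2 psi, continuous_solution_upto F k t psi &
    forall s, 0 <= s <= t -> psi s = maximal_solution s.
Proof.
move=> solv t tT; have [psi sol] := solv t tT.
by exists psi => // s; exact: maximal_solutionE sol s.
Qed.

Lemma solvable_upto_le (S T : R) : S <= T -> solvable_upto T -> solvable_upto S.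
Proof. by move=> ST [psi sol]; exists psi; exact: continuous_solution_upto_sub sol. Qed.

(** A continuous solution is bounded on the closed interval [[0, T]], hence extends. The supremum
    [maximal_time] is thus never attained. *)
Lemma solvable_upto_open (T : R) : 0 <= T -> solvable_upto T ->
  exists2 T', T < T' & solvable_upto T'.
Proof.
move=> T0 [psi sol].
have cn : {within `[0, T], continuous (fun t => norm1 (psi t))}.
  by apply: continuous_subspaceT; exact: norm1_continuous sol.1.
have [r _ rmax] := EVT_max T0 cn.
have solv t : 0 <= t < T -> solvable_upto t.
  by move=> /andP[_ tT]; apply: solvable_upto_le (ltW tT) _; exists psi.
have [|T' [phi [TT' phisol]]] := bounded_solution_extends C0 FC hk T0 (norm1_ge0 (psi r))
  (maximal_solution_pieces solv).
  move=> t /andP[t0 tT]; have tT' : 0 <= t <= T by rewrite t0 ltW.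
  by rewrite -(maximal_solutionE sol tT'); exact: rmax.
by exists T' => //; exists phi.
Qed.

Lemma solvable_upto0 : solvable_upto 0.
Proof.
have absurd (t : R) (P : Prop) : 0 <= t < 0 -> P by move=> /andP[t0]; rewrite ltNge t0.
have [T' [phi [T0 sol]]] := @bounded_solution_extends R d F k C 0 0 (fun=> 0) C0 FC hk
  (lexx 0) (lexx 0) (fun t => absurd t _) (fun t => absurd t _).
by apply: solvable_upto_le (ltW T0) _; exists phi.
Qed.

Lemma lt_maximal_time (t : R) : 0 <= t -> (t%:E < maximal_time)%E <-> solvable_upto t.
Proof.
move=> t0; split=> [/ereal_sup_gt[_ [T [T0 solT] <-]]|solt].
  by rewrite lte_fin => tT; exact: solvable_upto_le (ltW tT) solT.
have [T tT solT] := solvable_upto_open t0 solt.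
apply: (@lt_le_trans _ _ T%:E); first by rewrite lte_fin.
by apply: ereal_sup_ubound; exists T => //; split=> //; exact: le_trans t0 (ltW tT).
Qed.

Lemma maximal_solution_volterra (t : R) : 0 <= t -> (t%:E < maximal_time)%E ->
  volterra_at F k maximal_solution t.
Proof.
move=> t0 /(lt_maximal_time t0) [psi sol].
apply: (volterra_at_eq t0 (F := F) (phi := psi)) => [|s st|].
- by apply: (maximal_solutionE sol); rewrite t0/=.
- by rewrite (maximal_solutionE sol).
- by apply: sol.2; rewrite t0/=.
Qed.

Lemma maximal_solution_vec_L2 (T : R) : 0 <= T -> (T%:E < maximal_time)%E ->
  vec_L2 `[0, T] maximal_solution.
Proof.
move=> T0 /(lt_maximal_time T0) [psi sol].
apply: (@eq_vec_L2 _ _ _ psi).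
  by move=> t; rewrite inE/= in_itv/=; exact: maximal_solutionE sol t.
by apply: coordwise_continuous_vec_L2; exact: sol.1.
Qed.

Lemma maximal_solution_continuous :
  {within lifespan maximal_time, continuous maximal_solution}.
Proof.
apply/subspace_continuousP => t [t0 tT].
(* A solution reaching beyond [t] agrees with [maximal_solution] on both sides of [t] within the
   lifespan. *)
have [T' tT' [psi sol]] := solvable_upto_open t0 ((lt_maximal_time t0).1 tT).
have Et : psi t = maximal_solution t by apply: (maximal_solutionE sol); rewrite t0 ltW.
move=> A NA; have NA' : nbhs (psi t) A by rewrite Et.
have H : \forall s \near t, A (psi s) := coordwise_continuous_mx sol.1 NA'.
have sT' : \forall s \near t, s < T' by exact: lt_nbhsl.
apply: (@filterS2 _ _ (nbhs_filter t) _ _ _ _ H sT') => s As sT [s0 _].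
by rewrite /= /from_subspace -(maximal_solutionE sol) ?s0 ?ltW.
Qed.

Lemma maximal_solution_measurable (T : R) i : maximal_time = T%:E ->
  measurable_fun `[0, T] (fun t => maximal_solution t ord0 i).
Proof.
move=> TE; apply/measurable_fun_itv_bndo_bndcP.
have lE : lifespan maximal_time = `[0, T[%classic.
  by apply/seteqP; split=> t; rewrite /lifespan /= in_itv/= TE lte_fin;
    [move=> [-> ->]|move=> /andP[]].
rewrite -lE; apply: subspace_continuous_measurable_fun.
  by rewrite lE; exact: measurable_itv.
move=> t; apply: (@continuous_comp (subspace (lifespan maximal_time)) 'rV[R]_d R
  maximal_solution (fun M => M ord0 i)); first exact: maximal_solution_continuous.
exact: coord_continuous.
Qed.

Lemma maximal_time_gt0 : (0 < maximal_time)%E.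
Proof. exact/lt_maximal_time/solvable_upto0. Qed.

Lemma maximal_solution_blowup (T : R) : maximal_time = T%:E ->
  L2norm `[0, T] (fun t => enorm (maximal_solution t)) = +oo%E.
Proof.
move=> TE; apply/eqP; apply: contraT; rewrite -ltey => psi2.
have T0 : 0 < T by rewrite -lte_fin -TE maximal_time_gt0.
have solv t : 0 <= t < T -> solvable_upto t.
  by move=> /andP[t0 tT]; apply/lt_maximal_time => //; rewrite TE lte_fin.
have L2 : vec_L2 `[0, T] maximal_solution.
  by split=> // i; exact: maximal_solution_measurable.
have pieces := maximal_solution_pieces solv.
have [M M0 bnd] := square_integrable_solution_bounded C0 FC hk T0 L2 pieces.
have [T' [phi [TT' sol]]] := bounded_solution_extends C0 FC hk (ltW T0) M0 pieces bnd.
have : (T'%:E <= maximal_time)%E.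
  apply: ereal_sup_ubound; exists T' => //; split; last by exists phi.
  exact: le_trans (ltW T0) (ltW TT').
by rewrite TE lee_fin leNgt TT'.
Qed.

Lemma maximal_solution_agrees (T : R) (phi : R -> 'rV[R]_d) : 0 < T ->
  (T%:E < maximal_time)%E -> vec_L2 `[0, T] phi ->
  {ae (@lebesgue_measure R), forall t, 0 <= t <= T -> volterra_at F k phi t} ->
  forall t, 0 <= t <= T -> volterra_at F k phi t -> phi t = maximal_solution t.
Proof.
move=> T0 TT phi2 ae_phi t tT sphi.
have spsi s : 0 <= s <= T -> volterra_at F k maximal_solution s.
  move=> /andP[s0 sT]; apply: maximal_solution_volterra => //.
  by apply: le_lt_trans TT; rewrite lee_fin.
apply: (volterra_unique T0 C0 FC hk phi2 (maximal_solution_vec_L2 (ltW T0) TT) _ tT sphi (spsi _ tT)).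
apply: (@filterS _ _ (ae_filter_ringOfSetsType lebesgue_measure) _ _ _ ae_phi).
by move=> s sol sT; split; [exact: sol|exact: spsi].
Qed.

Lemma square_integrable_solution_lt_maximal_time (T : R) (phi : R -> 'rV[R]_d) : 0 < T ->
  vec_L2 `[0, T] phi ->
  {ae (@lebesgue_measure R), forall t, 0 <= t <= T -> volterra_at F k phi t} ->
  (T%:E < maximal_time)%E.
Proof.
move=> T0 phi2 ae_phi; rewrite ltNge; apply/negP => TT.
have [S SE] : exists S, maximal_time = S%:E.
  move: TT maximal_time_gt0; case: maximal_time => // r _ _; by exists r.
have S0 : 0 < S by rewrite -lte_fin -SE maximal_time_gt0.
have ST : S <= T by rewrite -lee_fin -SE.
have := maximal_solution_blowup SE.
suff : (L2norm `[0%R, S] (fun t => enorm (maximal_solution t)) < +oo)%E.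
  by move=> /[swap] ->; rewrite ltxx.
have [mphi phiS2] := vec_L2_sub ST phi2.
have mS : measurable (`[0, S] : set (measurableTypeR R)) by exact: measurable_itv.
have mpsi i := maximal_solution_measurable i SE.
have men (x : R -> 'rV[R]_d) : (forall i, measurable_fun `[0, S] (fun t => x t ord0 i)) ->
    measurable_fun `[0, S] (fun t => (norm1 (x t) ^+ 2)%:E).
  by move=> mx; apply/measurable_EFinP; apply: measurable_funX; exact: measurable_norm1.
apply/vec_L2P => //; move/vec_L2P : phiS2 => /(_ mS mphi); congr (_ < _)%E.
have mo (x : R -> 'rV[R]_d) : (forall i, measurable_fun `[0, S] (fun t => x t ord0 i)) ->
    measurable_fun `[0, S[ (fun t => (norm1 (x t) ^+ 2)%:E).
  by move=> mx; apply/emeasurable_fun_itv_bndo_bndcP; exact: men.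
(* The two functions need not agree at [S], so this null point is removed from the integrals. *)
rewrite -integral_itv_bndo_bndc; last exact: mo.
rewrite -[RHS]integral_itv_bndo_bndc; last exact: mo.
apply: ae_eq_integral => //; [exact: mo|exact: mo|].
apply: (@filterS _ _ (ae_filter_ringOfSetsType lebesgue_measure) _ _ _ ae_phi).
move=> t sol /=; rewrite in_itv/= => /andP[t0 tS].
(* Agreement is available only on intervals [[0, r]] with [0 < r < S]; the midpoint is positive even
   for [t = 0]. *)
pose r := (t + S) / 2.
have tr : t < r < S by rewrite /r; apply/andP; split; lra.
have r0 : 0 < r by case/andP: tr => tr _; exact: le_lt_trans t0 tr.
have rS : r < S by case/andP: tr.
congr (norm1 _ ^+ 2)%:E.
apply: (@maximal_solution_agrees r) => //.
- by rewrite SE lte_fin.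
- exact: vec_L2_sub (le_trans (ltW rS) ST) phi2.
- apply: (@filterS _ _ (ae_filter_ringOfSetsType lebesgue_measure) _ _ _ ae_phi).
  by move=> s ss /andP[s0 sr]; apply: ss; rewrite s0; lra.
- by rewrite t0 ltW//; case/andP: tr.
- by apply: sol; rewrite t0/=; lra.
Qed.

Theorem quad_lipschitz_maximal_solution :
  has_unique_noncontinuable_continuous_solution F (fun s => diag_mx (\row_i k i s)).
Proof.
exists maximal_solution, maximal_time; split.
- split.
  + exact: maximal_time_gt0.
  + by move=> T T0 TT; apply: maximal_solution_vec_L2 => //; exact: ltW.
  + by move=> t [t0 tT]; apply/solves_at_diagP; exact: maximal_solution_volterra.
  + exact: maximal_solution_blowup.
- exact: maximal_solution_continuous.
move=> T phi T0 phi2 ae_phi.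
have ae_phi' : {ae (@lebesgue_measure R), forall t, 0 <= t <= T -> volterra_at F k phi t}.
  apply: (@filterS _ _ (ae_filter_ringOfSetsType lebesgue_measure) _ _ _ ae_phi).
  by move=> t sol tT; apply/solves_at_diagP; exact: sol.
have TT := square_integrable_solution_lt_maximal_time T0 phi2 ae_phi'.
split=> // t tT /solves_at_diagP; exact: (maximal_solution_agrees T0 TT phi2 ae_phi').
Qed.
End MaximalSolution.

(** * Riccati equations *)

(** The common form of [F1] and [F2]: as all matrices in the quadratic term are diagonal, its
    coordinate [i] is a multiple of [u_i ^+ 2]. *)
Definition riccati (R : realType) (d : nat) (a : 'rV[R]_d) (Lambda : 'M[R]_d)
    (b : 'rV[R]_d) (u : 'rV[R]_d) : 'rV[R]_d :=
  a + u *m Lambda + \row_i (b ord0 i * u ord0 i ^+ 2).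

(** The linear part is Lipschitz with the sum of the absolute entries of [Lambda]; the quadratic
    part factors as a difference of squares. *)
Lemma riccati_quad_lipschitz (R : realType) (d : nat) (a : 'rV[R]_d)
    (Lambda : 'M[R]_d) (b : 'rV[R]_d) :
  exists2 C, 0 <= C & quad_lipschitz C (riccati a Lambda b).
Proof.
pose N := \sum_i \sum_j `|Lambda i j|.
have LN i j : `|Lambda i j| <= N.
  apply: (@le_trans _ _ (\sum_j `|Lambda i j|)).
    by rewrite (bigD1 j)//= lerDl sumr_ge0.
  by rewrite /N [leRHS](bigD1 i)//= lerDl sumr_ge0// => l _; exact: sumr_ge0.
have N0 : 0 <= N by apply: sumr_ge0 => i _; exact: sumr_ge0.
exists (N + norm1 b); first by rewrite addr_ge0 ?norm1_ge0.
move=> u v i; rewrite /riccati !mxE.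
set S := \sum_j u ord0 j * _; set S' := \sum_j v ord0 j * _.
have -> : a ord0 i + S + b ord0 i * u ord0 i ^+ 2 - (a ord0 i + S' + b ord0 i * v ord0 i ^+ 2)
  = (S - S') + b ord0 i * ((u - v) ord0 i * (u ord0 i + v ord0 i)) by rewrite !mxE; ring.
have hS : `|S - S'| <= N * norm1 (u - v).
  rewrite /S /S' -sumrB (le_trans (ler_norm_sum _ _ _))// /norm1 mulr_sumr.
  by apply: ler_sum => j _; rewrite -mulrBl normrM !mxE mulrC ler_wpM2r.
have n0 := norm1_ge0 (u - v); have nu := norm1_ge0 u; have nv := norm1_ge0 v.
have hb : `|b ord0 i * ((u - v) ord0 i * (u ord0 i + v ord0 i))| <=
    norm1 b * (norm1 (u - v) * (norm1 u + norm1 v)).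
  rewrite !normrM.
  apply: (ler_pM (normr_ge0 _) (mulr_ge0 (normr_ge0 _) (normr_ge0 _)) (norm1_coord _ _)).
  apply: (ler_pM (normr_ge0 _) (normr_ge0 _) (norm1_coord _ _)).
  by rewrite (le_trans (ler_normD _ _))// lerD// norm1_coord.
apply: le_trans (ler_normD _ _) _; apply: le_trans (lerD hS hb) _.
rewrite mulrDl lerD//.
  by rewrite ler_wpM2l// ler_peMr// -addrA lerDl addr_ge0.
by rewrite ler_wpM2l ?norm1_ge0// ler_wpM2l// lerD2r lerDr.
Qed.

Lemma riccati_maximal_solution (R : realType) (d : nat) (a : 'rV[R]_d)
    (Lambda : 'M[R]_d) (b : 'rV[R]_d) (k : 'I_d -> R -> R) :
  (forall i, L2loc (k i)) ->
  has_unique_noncontinuable_continuous_solution (riccati a Lambda b)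
    (fun s => diag_mx (\row_i k i s)).
Proof.
move=> hk; have [C C0 FC] := riccati_quad_lipschitz a Lambda b.
exact: quad_lipschitz_maximal_solution C0 FC hk.
Qed.

Lemma diag_mx_sqr (R : realType) (d : nat) (v : 'rV[R]_d) :
  diag_mx v ^+ 2 = diag_mx (\row_i v ord0 i ^+ 2).
Proof.
by rewrite expr2 -[_ * _]/(_ *m _) mulmx_diag; congr diag_mx; apply/rowP => i; rewrite !mxE expr2.
Qed.

Lemma F1E (R : realType) (d : nat) (gamma c : R) (theta nu : 'rV[R]_d)
    (Lambda : 'M[R]_d) :
  F1 gamma c theta nu Lambda =
  riccati ((gamma / (2 * c * (1 - gamma))) *: (theta *m diag_mx theta)) Lambda
    (\row_i (2^-1 * nu ord0 i ^+ 2)).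
Proof.
apply/funext => u; rewrite /F1 /riccati diag_mx_sqr; congr (_ + _).
by apply/rowP => i; rewrite !mul_mx_diag !mxE; ring.
Qed.

Lemma F2E (R : realType) (d : nat) (gamma : R) (theta nu rho : 'rV[R]_d)
    (Lambda : 'M[R]_d) :
  F2 gamma theta nu rho Lambda =
  riccati ((gamma / (2 * (1 - gamma))) *: (theta *m diag_mx theta)) Lambda
    (\row_i (2^-1 * (nu ord0 i ^+ 2 + gamma / (1 - gamma) * (nu ord0 i ^+ 2 * rho ord0 i ^+ 2)))).
Proof.
apply/funext => u; rewrite /F2 /riccati !diag_mx_sqr; congr (_ + _).
by apply/rowP => i; rewrite !mul_mx_diag !mxE; ring.
Qed.

Unset Implicit Arguments.

Theorem theorem6p2 (R : realType) (d : nat) (hd : (1 <= d)%N)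
    (gamma : R) (hgamma : 0 < gamma < 1)
    (theta nu rho : 'rV[R]_d)
    (htheta : forall i, 0 <= theta ord0 i)
    (hrho : forall i, -1 <= rho ord0 i <= 1)
    (D : 'M[R]_d) (hD : forall i j, i != j -> 0 <= D i j)
    (k : 'I_d -> R -> R) (hk : forall i, L2loc (k i)) :
  let Lambda := D + (gamma / (1 - gamma)) *:
                    (diag_mx nu *m diag_mx rho *m diag_mx theta) in
  let K := fun s : R => diag_mx (\row_i k i s) in
  (forall (r c : R), (forall i, rho ord0 i = r) ->
     c = (1 - gamma) / (1 - gamma + gamma * r ^+ 2) ->
     has_unique_noncontinuable_continuous_solution
       (F1 gamma c theta nu Lambda) K)
  /\ has_unique_noncontinuable_continuous_solution
       (F2 gamma theta nu rho Lambda) K.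
Proof.
move=> Lambda K; split=> [r c _ _|]; rewrite ?F1E ?F2E; exact: riccati_maximal_solution.
Qed.
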